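(* There is a computable copy $\mathcal{L}$ of $\omega$ such that for every $\Delta_2$ cohesive set $C$, $\prod_C \mathcal{L} \cong \omega + \eta$.
   Context: $\Delta_2$ refers to the arithmetical hierarchy of subsets of $\mathbb{N}$; c.e. means computably enumerable. For $X, Y \subseteq \mathbb{N}$, $X \subseteq^* Y$ means that $X \setminus Y$ is finite. A set $C \subseteq \mathbb{N}$ is cohesive if it is infinite and for every c.e. set $W$, either $C \subseteq^* W$ or $C \subseteq^* \mathbb{N} \setminus W$. A computable linear order $\mathcal{L} = (L; \prec_{\mathcal{L}})$ consists of a non-empty computable set $L \subseteq \mathbb{N}$ and a computable (strict) linear order relation $\prec_{\mathcal{L}}$ on $L$. A computable copy of $\omega$ is a computable linear order that is isomorphic to $(\mathbb{N}; <)$ (by a not necessarily computable isomorphism). $\omega$ and $\eta$ denote the order-types of $(\mathbb{N};<)$ and $(\mathbb{Q};<)$, and $+$ is the usual sum of linear orders. Cohesive power: for a computable linear order $\mathcal{L} = (L; \prec_{\mathcal{L}})$ and a cohesive set $C$, let $D$ be the set of partial computable functions $\varphi \colon \mathbb{N} \rightharpoonup L$ with $C \subseteq^* \mathrm{dom}(\varphi)$. For $\varphi, \psi \in D$, let $\varphi =_C \psi$ if $C \subseteq^* \{n : \varphi(n)\downarrow = \psi(n)\downarrow\}$; this is an equivalence relation, and $[\varphi]$ denotes the class of $\varphi$. The cohesive power $\prod_C \mathcal{L}$ is the linear order with domain $\{[\varphi] : \varphi \in D\}$ where $[\psi] \prec [\varphi]$ if and only if $C \subseteq^* \{n : \psi(n)\downarrow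 \prec_{\mathcal{L}} \varphi(n)\downarrow\}$. *)

(* Defs.v *)
From HB Require Import structures.
From mathcomp Require Import all_boot all_order all_algebra.
From mathcomp Require Import boolp classical_sets functions cardinality.

Set Implicit Arguments.
Unset Strict Implicit.
Unset Printing Implicit Defensive.

Local Open Scope classical_set_scope.

(** * Computability, by Kleene's mu-recursive functions *)

Inductive recf : Type :=
  | RZero
  | RSucc
  | RProj of nat
  | RComp of recf & seq recf
  | RPrec of recf & recf
  | RMu of recf.

(** [computes c v y]: the partial function denoted by [c] converges to [y] on
    the argument list [v].  Codes carry no arity; the partial k-ary function
    denoted by [c] is its restriction to lists of length k, and reading missing
    arguments as 0 yields no function beyond the mu-recursive ones.
    Minimization and recursion act on the first argument:
    [RPrec f g] is h(0,v) = f(v), h(n+1,v) = g(n,h(n,v),v), and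
    [RMu f] is the least y with f(y,v) = 0, provided that
    f(z,v) is defined for every z < y. *)
Fixpoint computes (c : recf) (v : seq nat) (y : nat) {struct c} : Prop :=
  match c with
  | RZero => y = 0
  | RSucc => y = (head 0 v).+1
  | RProj i => y = nth 0 v i
  | RComp f gs =>
      exists2 ws : seq nat,
        (fix computes_all (gs : seq recf) (ws : seq nat) {struct gs} : Prop :=
           match gs, ws with
           | [::], [::] => True
           | g :: gs', w :: ws' => computes g v w /\ computes_all gs' ws'
           | _, _ => False
           end) gs ws
        & computes f ws y
  | RPrec f g =>
      (fix prec (n : nat) (y : nat) {struct n} : Prop :=
         match n with
         | 0 => computes f (behead v) y
         | n'.+1 => exists2 r, prec n' r & computes g [:: n', r & behead v] y
         end) (head 0 v) y
  | RMu f =>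
      computes f (y :: v) 0
      /\ forall z, z < y -> exists w, computes f (z :: v) w.+1
  end.

(** A partial function is an [option]-valued function, [None] for divergence. *)
Definition partial_computable (phi : nat -> option nat) : Prop :=
  exists c, forall n y, phi n = Some y <-> computes c [:: n] y.

(** Computable sets and relations have computable characteristic functions;
    booleans are coerced to 0 and 1. *)
Definition computable_set (A : pred nat) : Prop :=
  exists c, forall n, computes c [:: n] (A n).

Definition computable_rel2 (R : nat -> nat -> bool) : Prop :=
  exists c, forall m n, computes c [:: m; n] (R m n).

Definition computable_rel3 (R : nat -> nat -> nat -> bool) : Prop :=
  exists c, forall m n p, computes c [:: m; n; p] (R m n p).

Definition ce_set (W : set nat) : Prop :=
  exists c, W = [set n | exists y, computes c [:: n] y].

Definition Sigma2 (A : set nat) : Prop :=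
  exists2 R, computable_rel3 R & A = [set n | exists x, forall y, R n x y].

Definition Pi2 (A : set nat) : Prop :=
  exists2 R, computable_rel3 R & A = [set n | forall x, exists y, R n x y].

Definition Delta2 (A : set nat) : Prop := Sigma2 A /\ Pi2 A.

(** * Cohesive sets *)

Definition almost_subset (X Y : set nat) : Prop := finite_set (X `\` Y).

Definition cohesive (C : set nat) : Prop :=
  infinite_set C /\
  forall W, ce_set W -> almost_subset C W \/ almost_subset C (~` W).

(** * Orders, given as a type with a strict order relation *)

Definition order_iso (A B : Type)
    (ltA : A -> A -> Prop) (ltB : B -> B -> Prop) : Prop :=
  exists2 f : A -> B, bijective f & forall x y, ltA x y <-> ltB (f x) (f y).

Definition sum_lt (A B : Type) (ltA : A -> A -> Prop) (ltB : B -> B -> Prop)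
    (x y : A + B) : Prop :=
  match x, y with
  | inl a, inl a' => ltA a a'
  | inl _, inr _ => True
  | inr _, inl _ => False
  | inr b, inr b' => ltB b b'
  end.

Definition omega_lt (m n : nat) : Prop := m < n.

Definition eta_lt (p q : rat) : Prop := (p < q)%R.

(** The strict order is a subset of [clo_dom] x [clo_dom]. *)
Record computable_linear_order := ComputableLinearOrder {
  clo_dom : pred nat;
  clo_lt : nat -> nat -> bool;
  clo_dom_nonempty : exists n, clo_dom n;
  clo_dom_computable : computable_set clo_dom;
  clo_lt_computable : computable_rel2 clo_lt;
  clo_lt_dom : forall m n, clo_lt m n -> clo_dom m /\ clo_dom n;
  clo_lt_irr : forall n, ~~ clo_lt n n;
  clo_lt_trans : forall m n p, clo_lt m n -> clo_lt n p -> clo_lt m p;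
  clo_lt_total : forall m n, clo_dom m -> clo_dom n ->
    [\/ clo_lt m n, m = n | clo_lt n m]
}.

Definition computable_copy_of_omega (L : computable_linear_order) : Prop :=
  order_iso (fun x y : {n | clo_dom L n} => clo_lt L (val x) (val y)) omega_lt.

(** * Cohesive powers *)

Definition cpow_dom (L : computable_linear_order) (C : set nat) :
    set (nat -> option nat) :=
  [set phi | [/\ partial_computable phi,
                 forall n x, phi n = Some x -> clo_dom L x
               & almost_subset C [set n | phi n != None]]].

Definition cpow_eq (C : set nat) (phi psi : nat -> option nat) : Prop :=
  almost_subset C [set n | exists x, phi n = Some x /\ psi n = Some x].

Definition cpow_class (L : computable_linear_order) (C : set nat)
    (phi : nat -> option nat) : set (nat -> option nat) :=
  [set psi | cpow_dom L C psi /\ cpow_eq C phi psi].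

Definition cohesive_power (L : computable_linear_order) (C : set nat) : Type :=
  set_type (cpow_class L C @` cpow_dom L C).

(** The order is invariant under [cpow_eq], so one pair of representatives
    decides it. *)
Definition cpow_lt (L : computable_linear_order) (C : set nat)
    (X Y : cohesive_power L C) : Prop :=
  exists psi phi : nat -> option nat,
    [/\ set_val X psi, set_val Y phi &
        almost_subset C [set n | exists x y,
          [/\ psi n = Some x, phi n = Some y & clo_lt L x y]]].

Arguments cpow_lt : clear implicits.

(* Main.v *)
Require Import Defs.
From mathcomp Require Import all_boot all_order all_algebra.
From mathcomp Require Import boolp classical_sets functions cardinality.

(** Idea.  The order consists of consecutive finite blocks; block [j] starts as a
    single point and is refined at most [j * j] times, each refinement inserting a
    point into every gap, including the gap before the next block.  So the order
    has type omega, and the first points of the blocks show that the nonstandard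
    part of a cohesive power has neither a least nor a greatest element.  Suppose
    that [phi] and [psi] represent nonstandard elements, and that [psi n] is the
    successor of [phi n] for almost all [n] in [C].  Then no further refinement of
    the block of [phi n] takes place once both points are present, so the final
    number of refinements of that block is computable on [C].  It therefore
    suffices to refine in such a way that every infinite Delta_2 set [J] of blocks
    contains infinitely many blocks that were refined on its behalf an even number
    of times, and infinitely many an odd number of times: with [J] included in the
    blocks met by [phi] on [C], the resulting parity is a c.e. property that splits
    [C], against cohesiveness.  Hence the nonstandard part is a countable dense
    order without endpoints. *)

Set Implicit Arguments.
Unset Strict Implicit.
Unset Printing Implicit Defensive.

Local Open Scope classical_set_scope.

(** * Computable functions *)

(** [computes_all] and [prec_graph] name the anonymous fixpoints inside [computes], so that
    inductions about them can be stated; the unfolding lemmas hold by conversion. *)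
Definition computes_all (v : seq nat) :=
  fix computes_all (gs : seq recf) (ws : seq nat) {struct gs} : Prop :=
  match gs, ws with
  | [::], [::] => True
  | g :: gs', w :: ws' => computes g v w /\ computes_all gs' ws'
  | _, _ => False
  end.

Lemma computes_comp f gs v y :
  computes (RComp f gs) v y <->
  exists2 ws, computes_all v gs ws & computes f ws y.
Proof. exact: iff_refl. Qed.

Definition prec_graph (f g : recf) (v : seq nat) :=
  fix prec (n : nat) (y : nat) {struct n} : Prop :=
  match n with
  | 0 => computes f v y
  | n'.+1 => exists2 r, prec n' r & computes g [:: n', r & v] y
  end.

Lemma computes_prec f g v y :
  computes (RPrec f g) v y <-> prec_graph f g (behead v) (head 0 v) y.
Proof. exact: iff_refl. Qed.

Fixpoint all_recf (P : recf -> Prop) (gs : seq recf) : Prop :=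
  if gs is g :: gs' then P g /\ all_recf P gs' else True.

(** The generated induction principle gives no hypothesis for the codes listed under [RComp]; this
    one does. *)
Lemma recf_nested_ind (P : recf -> Prop) :
  P RZero -> P RSucc -> (forall i, P (RProj i)) ->
  (forall f gs, P f -> all_recf P gs -> P (RComp f gs)) ->
  (forall f g, P f -> P g -> P (RPrec f g)) ->
  (forall f, P f -> P (RMu f)) -> forall c, P c.
Proof.
move=> P0 PS Pi PC PP PM; fix IH 1; case=> [|||f gs|f g|f]; last first.
- exact: PM.
- exact: PP.
- by apply: PC => //; elim: gs => //= g gs IHgs; split.
- exact: Pi.
- exact: PS.
- exact: P0.
Qed.

Lemma computes_inj c v y y' : computes c v y -> computes c v y' -> y = y'.
Proof.
elim/recf_nested_ind: c v y y' => [v y y' -> ->|v y y' -> ->|i v y y' -> ->||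
    f g IHf IHg|f IHf] //.
- move=> f gs IHf IHgs v y y' /computes_comp[ws Hws fy] /computes_comp[ws' Hws' fy'].
  suff E : ws = ws' by rewrite -E in fy'; exact: IHf fy fy'.
  elim: gs IHgs ws ws' Hws Hws' {fy fy'} => [|g gs IH] /=.
    by move=> _ [|? ?] [|? ?].
  case=> IHg IHgs [|w ws] [|w' ws'] //= [gw Hws] [gw' Hws'].
  by rewrite (IHg _ _ _ gw gw') (IH IHgs _ _ Hws Hws').
- move=> v y y' /computes_prec + /computes_prec.
  elim: (head 0 v) y y' => [|n IH] y y' /=; first exact: IHf.
  move=> [r Hr gy] [r' Hr' gy']; rewrite -(IH _ _ Hr Hr') in gy'.
  exact: IHg gy gy'.
- move=> v y y' [fy lty] [fy' lty'].
  case: (ltngtP y y') => // [/lty'|/lty] [w Hw].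
    by have := IHf _ _ _ fy Hw.
  by have := IHf _ _ _ fy' Hw.
Qed.

(** * Total computable functions of an argument list *)

Definition compv (f : seq nat -> nat) : Prop :=
  exists c, forall v, computes c v (f v).

Lemma compv_const k : compv (fun=> k).
Proof.
elim: k => [|k [c Hc]]; first by exists RZero.
exists (RComp RSucc [:: c]) => v; apply/computes_comp.
by exists [:: k].
Qed.

Lemma compv_nth i : compv (fun v => nth 0 v i).
Proof. by exists (RProj i). Qed.

Lemma compv_comp1 h f : compv h -> compv f -> compv (fun v => h [:: f v]).
Proof.
move=> [ch Hh] [cf Hf]; exists (RComp ch [:: cf]) => v.
by apply/computes_comp; exists [:: f v].
Qed.

Lemma compv_comp2 h f g :
  compv h -> compv f -> compv g -> compv (fun v => h [:: f v; g v]).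
Proof.
move=> [ch Hh] [cf Hf] [cg Hg]; exists (RComp ch [:: cf; cg]) => v.
by apply/computes_comp; exists [:: f v; g v].
Qed.

Lemma compv_comp3 h f g k :
  compv h -> compv f -> compv g -> compv k ->
  compv (fun v => h [:: f v; g v; k v]).
Proof.
move=> [ch Hh] [cf Hf] [cg Hg] [ck Hk]; exists (RComp ch [:: cf; cg; ck]) => v.
by apply/computes_comp; exists [:: f v; g v; k v].
Qed.

Lemma compv_prec f g : compv f -> compv g ->
  compv (fun v => nat_rec (fun=> nat) (f (behead v))
    (fun n r => g [:: n, r & behead v]) (head 0 v)).
Proof.
move=> [cf Hf] [cg Hg]; exists (RPrec cf cg) => v; apply/computes_prec.
elim: (head 0 v) => [|n IH] /=; first exact: Hf.
by eexists; first exact: IH.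
Qed.

Lemma eq_compv f g : f =1 g -> compv f -> compv g.
Proof. by move=> E [c Hc]; exists c => v; rewrite -E. Qed.

Lemma compvS f : compv f -> compv (fun v => (f v).+1).
Proof.
move=> cf; apply: (compv_comp1 (h := fun v => (head 0 v).+1)) => //.
by exists RSucc.
Qed.

Lemma compv_add f g : compv f -> compv g -> compv (fun v => f v + g v).
Proof.
move=> cf cg; have := compv_comp2 (compv_prec (compv_nth 0)
  (compvS (compv_nth 1))) cf cg.
apply: eq_compv => v /=; elim: (f v) => //= n ->.
by rewrite addSn.
Qed.

Lemma compv_pred f : compv f -> compv (fun v => (f v).-1).
Proof.
move=> cf; have := compv_comp1 (compv_prec (compv_const 0) (compv_nth 0)) cf.
by apply: eq_compv => v /=; case: (f v).
Qed.

Lemma compv_sub f g : compv f -> compv g -> compv (fun v => f v - g v).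
Proof.
move=> cf cg; have := compv_comp2 (compv_prec (compv_nth 0)
  (compv_pred (compv_nth 1))) cg cf.
apply: eq_compv => v /=; elim: (g v) => /= [|n ->]; first by rewrite subn0.
by rewrite subnS.
Qed.

Lemma compv_mul f g : compv f -> compv g -> compv (fun v => f v * g v).
Proof.
move=> cf cg; have := compv_comp2 (compv_prec (compv_const 0)
  (compv_add (compv_nth 2) (compv_nth 1))) cf cg.
by apply: eq_compv => v /=; elim: (f v) => //= n ->; rewrite mulSn.
Qed.

Lemma compv_leq f g : compv f -> compv g -> compv (fun v => f v <= g v : nat).
Proof.
move=> cf cg; have := compv_sub (compv_const 1) (compv_sub cf cg).
by apply: eq_compv => v; rewrite /leq; case: (f v - g v).
Qed.

Lemma compv_if f g h : compv f -> compv g -> compv h ->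
  compv (fun v => if f v != 0 then g v else h v).
Proof.
move=> cf cg ch; have := compv_comp3 (compv_prec (compv_nth 1)
  (compv_nth 2)) cf cg ch.
by apply: eq_compv => v /=; case: (f v).
Qed.

(** * Integer square root and pairing *)

Fixpoint isqrt (n : nat) : nat :=
  if n is n'.+1 then let r := isqrt n' in
    if r.+1 * r.+1 <= n then r.+1 else r
  else 0.

Lemma isqrtP n : isqrt n * isqrt n <= n < (isqrt n).+1 * (isqrt n).+1.
Proof.
elim: n => //= n /andP[le_n lt_n]; case: ifP => [->|/negbT]; last first.
  by rewrite -ltnNge => ->; rewrite andbT leqW.
by apply: leq_ltn_trans lt_n _; rewrite ltn_mul.
Qed.

Lemma isqrt_eq n r : r * r <= n < r.+1 * r.+1 -> isqrt n = r.
Proof.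
move=> /andP[le_n lt_n]; have /andP[le_q lt_q] := isqrtP n.
case: (ltngtP (isqrt n) r) => // lt.
  by have := leq_trans lt_q (leq_trans (leq_mul lt lt) le_n); rewrite ltnn.
by have := leq_trans lt_n (leq_trans (leq_mul lt lt) le_q); rewrite ltnn.
Qed.

(** [npair a b] lies between the squares of [a + b] and [a + b + 1], so the integer square root
    recovers the sum, and the remainder is [a]. *)
Definition npair (a b : nat) : nat := (a + b) * (a + b) + a.

(* Clamping makes [npair (pi1 x) (pi2 x) <= x] hold even though [npair] is not
   surjective. *)
Definition pi1 (x : nat) : nat := minn (x - isqrt x * isqrt x) (isqrt x).
Definition pi2 (x : nat) : nat := isqrt x - pi1 x.

Arguments npair : simpl never.
Arguments pi1 : simpl never.
Arguments pi2 : simpl never.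

Lemma isqrt_npair a b : isqrt (npair a b) = a + b.
Proof.
apply: isqrt_eq; rewrite leq_addr /= /npair mulSn mulnS addSn ltnS addnA.
by rewrite [X in _ <= X]addnC leq_add2l (leq_trans (leq_addr b a)) ?leq_addr.
Qed.

Lemma pi1K a b : pi1 (npair a b) = a.
Proof. by rewrite /pi1 isqrt_npair /npair addKn; apply/minn_idPl/leq_addr. Qed.

Lemma pi2K a b : pi2 (npair a b) = b.
Proof. by rewrite /pi2 isqrt_npair pi1K addKn. Qed.

Definition piK := (pi1K, pi2K).

Lemma pair_pi_leq x : npair (pi1 x) (pi2 x) <= x.
Proof.
have /andP[le_x _] := isqrtP x.
rewrite /npair /pi2 subnKC ?geq_minr // -leq_subRL //.
exact: geq_minl.
Qed.

Lemma ltn_npair a b a' b' :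
  a <= a' -> b <= b' -> (a < a') || (b < b') -> npair a b < npair a' b'.
Proof.
move=> la lb lt; have ls : a + b < a' + b'.
  by case/orP: lt => lt; [rewrite -addSn | rewrite -addnS]; rewrite leq_add.
apply: leq_trans (_ : (a' + b') * (a' + b') <= _); last exact: leq_addr.
apply: leq_trans (leq_mul ls ls); rewrite /npair mulSn mulnS addSn ltnS addnA.
by rewrite [X in _ <= X]addnC leq_add2l (leq_trans (leq_addr b a)) ?leq_addr.
Qed.

Lemma compv_isqrt f : compv f -> compv (fun v => isqrt (f v)).
Proof.
move=> cf; pose r := fun v : seq nat => (nth 0 v 1).+1.
have cr : compv r by apply/compvS/compv_nth.
have := compv_comp1 (compv_prec (compv_const 0) (compv_if (compv_leq
  (compv_mul cr cr) (compvS (compv_nth 0))) cr (compv_nth 1))) cf.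
apply: eq_compv => v /=; elim: (f v) => //= n ->.
by rewrite /r /=; case: ifP; case: ifP.
Qed.

(** * Closure properties of unary computable functions *)

(* Functions of several arguments are handled through [npair], so that every
   closure property can be used in the syntax-directed way of [comp]. *)
Definition comp1 (f : nat -> nat) : Prop :=
  exists c, forall x, computes c [:: x] (f x).

Lemma comp1_compv f : compv f -> comp1 (fun x => f [:: x]).
Proof. by move=> [c Hc]; exists c. Qed.

Lemma eq_comp1 f g : f =1 g -> comp1 f -> comp1 g.
Proof. by move=> E [c Hc]; exists c => x; rewrite -E. Qed.

Lemma comp1_const k : comp1 (fun=> k).
Proof. exact: (comp1_compv (compv_const k)). Qed.

Lemma comp1_id : comp1 (fun x => x).
Proof. exact: (comp1_compv (compv_nth 0)). Qed.

Lemma comp1_op1 h f : compv (fun v => h (nth 0 v 0)) -> comp1 f ->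
  comp1 (fun x => h (f x)).
Proof.
move=> [ch Hh] [cf Hf]; exists (RComp ch [:: cf]) => x.
by apply/computes_comp; exists [:: f x] => //; exact: (Hh [:: f x]).
Qed.

Lemma comp1_op2 h f g : compv (fun v => h (nth 0 v 0) (nth 0 v 1)) ->
  comp1 f -> comp1 g -> comp1 (fun x => h (f x) (g x)).
Proof.
move=> [ch Hh] [cf Hf] [cg Hg]; exists (RComp ch [:: cf; cg]) => x.
by apply/computes_comp; exists [:: f x; g x] => //; exact: (Hh [:: f x; g x]).
Qed.

Lemma comp1_op3 h f g k :
  compv (fun v => h (nth 0 v 0) (nth 0 v 1) (nth 0 v 2)) ->
  comp1 f -> comp1 g -> comp1 k -> comp1 (fun x => h (f x) (g x) (k x)).
Proof.
move=> [ch Hh] [cf Hf] [cg Hg] [ck Hk].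
exists (RComp ch [:: cf; cg; ck]) => x; apply/computes_comp.
by exists [:: f x; g x; k x] => //; exact: (Hh [:: f x; g x; k x]).
Qed.

Lemma comp1_subst h f : comp1 h -> comp1 f -> comp1 (fun x => h (f x)).
Proof.
move=> [ch Hh] [cf Hf]; exists (RComp ch [:: cf]) => x.
by apply/computes_comp; exists [:: f x].
Qed.

Lemma comp1S f : comp1 f -> comp1 (fun x => (f x).+1).
Proof. by apply: (comp1_op1 (h := S)); apply/compvS/compv_nth. Qed.

Lemma comp1_pred f : comp1 f -> comp1 (fun x => (f x).-1).
Proof. by apply: (comp1_op1 (h := predn)); apply/compv_pred/compv_nth. Qed.

Lemma comp1_add f g : comp1 f -> comp1 g -> comp1 (fun x => f x + g x).
Proof. by apply: (comp1_op2 (h := addn)); apply/compv_add; apply/compv_nth. Qed.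

Lemma comp1_sub f g : comp1 f -> comp1 g -> comp1 (fun x => f x - g x).
Proof. by apply: (comp1_op2 (h := subn)); apply/compv_sub; apply/compv_nth. Qed.

Lemma comp1_mul f g : comp1 f -> comp1 g -> comp1 (fun x => f x * g x).
Proof. by apply: (comp1_op2 (h := muln)); apply/compv_mul; apply/compv_nth. Qed.

Lemma comp1_leq f g : comp1 f -> comp1 g -> comp1 (fun x => f x <= g x : nat).
Proof.
by apply: (comp1_op2 (h := fun a b => a <= b : nat)); apply/compv_leq;
  apply/compv_nth.
Qed.

Lemma comp1_if (b : pred nat) f g : comp1 (fun x => b x : nat) -> comp1 f -> comp1 g ->
  comp1 (fun x => if b x then f x else g x).
Proof.
move=> cb cf cg; have := @comp1_op3 (fun a b c => if a != 0 then b else c) _ _ _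
  (compv_if (compv_nth 0) (compv_nth 1) (compv_nth 2)) cb cf cg.
by apply: eq_comp1 => x; case: (b x).
Qed.

Lemma comp1_neg (b : pred nat) : comp1 (fun x => b x : nat) -> comp1 (fun x => ~~ b x : nat).
Proof.
move=> cb; have := comp1_if cb (comp1_const 0) (comp1_const 1).
by apply: eq_comp1 => x; case: (b x).
Qed.

Lemma comp1_and (b b' : pred nat) : comp1 (fun x => b x : nat) ->
  comp1 (fun x => b' x : nat) -> comp1 (fun x => b x && b' x : nat).
Proof.
move=> cb cb'; have := comp1_if cb cb' (comp1_const 0).
by apply: eq_comp1 => x; case: (b x).
Qed.

Lemma comp1_or (b b' : pred nat) : comp1 (fun x => b x : nat) ->
  comp1 (fun x => b' x : nat) -> comp1 (fun x => b x || b' x : nat).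
Proof.
move=> cb cb'; have := comp1_if cb (comp1_const 1) cb'.
by apply: eq_comp1 => x; case: (b x).
Qed.

Lemma comp1_eqn f g : comp1 f -> comp1 g -> comp1 (fun x => f x == g x : nat).
Proof.
move=> cf cg; have := comp1_and (comp1_leq cf cg) (comp1_leq cg cf).
by apply: eq_comp1 => x; rewrite eqn_leq.
Qed.

Lemma comp1_eqb (b b' : pred nat) : comp1 (fun x => b x : nat) ->
  comp1 (fun x => b' x : nat) -> comp1 (fun x => b x == b' x : nat).
Proof.
move=> cb cb'; have := comp1_eqn cb cb'.
by apply: eq_comp1 => x; case: (b x); case: (b' x).
Qed.

Lemma comp1_npair f g : comp1 f -> comp1 g -> comp1 (fun x => npair (f x) (g x)).
Proof.
apply: comp1_op2; have c := compv_add (compv_nth 0) (compv_nth 1).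
exact: compv_add (compv_mul c c) (compv_nth 0).
Qed.

Lemma compv_pi1 : compv (fun v => pi1 (nth 0 v 0)).
Proof.
have cs := compv_isqrt (compv_nth 0).
have cd := compv_sub (compv_nth 0) (compv_mul cs cs).
apply: eq_compv (compv_if (compv_leq cd cs) cd cs) => v.
by rewrite /pi1 minnC /minn ltnNge; case: leqP.
Qed.

Lemma comp1_pi1 f : comp1 f -> comp1 (fun x => pi1 (f x)).
Proof. exact: comp1_op1 compv_pi1. Qed.

Lemma comp1_pi2 f : comp1 f -> comp1 (fun x => pi2 (f x)).
Proof.
apply: comp1_op1; exact: compv_sub (compv_isqrt (compv_nth 0)) compv_pi1.
Qed.

(** The parameter [x] is passed to [RPrec] as its extra argument; the step function gets [x], the
    counter and the previous value packed into one number. *)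
Lemma comp1_nat_rec (n a : nat -> nat) (g : nat -> nat -> nat -> nat) :
  comp1 n -> comp1 a ->
  comp1 (fun z => g (pi1 z) (pi1 (pi2 z)) (pi2 (pi2 z))) ->
  comp1 (fun x => nat_rec (fun=> nat) (a x) (g x) (n x)).
Proof.
move=> [cn Hn] [ca Ha] [cg Hg].
have [cp Hp] : compv (fun v => npair (nth 0 v 2) (npair (nth 0 v 0) (nth 0 v 1))).
  have cpr i f : compv f -> compv (fun v => npair (nth 0 v i) (f v)).
    move=> cf; have cs := compv_add (compv_nth i) cf.
    exact: compv_add (compv_mul cs cs) (compv_nth i).
  exact/cpr/cpr/compv_nth.
exists (RComp (RPrec ca (RComp cg [:: cp])) [:: cn; RProj 0]) => x.
apply/computes_comp; exists [:: n x; x] => //; apply/computes_prec => /=.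
elim: (n x) => [|k IH] /=; first exact: Ha.
set r := nat_rec _ _ _ _ in IH *; exists r => //.
exists [:: npair x (npair k r)]; first by split=> //; exact: (Hp [:: k; r; x]).
by have := Hg (npair x (npair k r)); rewrite !piK.
Qed.

Lemma comp1_iter (n a : nat -> nat) (g : nat -> nat -> nat) :
  comp1 n -> comp1 a -> comp1 (fun z => g (pi1 z) (pi2 z)) ->
  comp1 (fun x => iter (n x) (g x) (a x)).
Proof.
move=> cn ca cg; have := @comp1_nat_rec n a (fun x _ => g x) cn ca.
move=> /(_ (eq_comp1 _ (comp1_subst cg (comp1_npair (comp1_pi1 comp1_id)
  (comp1_pi2 (comp1_pi2 comp1_id)))))) H.
apply: eq_comp1 (H _) => [x|z]; last by rewrite !piK.
by elim: (n x) => //= k ->.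
Qed.

(** * Bounded search *)

Fixpoint bmin (P : pred nat) (n : nat) : nat :=
  if n is n'.+1 then let r := bmin P n' in
    if r < n' then r else if P n' then n' else n
  else 0.

(** The value [n] signals that the search below [n] failed, so [bmin P n < n] is a bounded
    existential quantifier. *)
Lemma bminP P n :
  [/\ bmin P n <= n, bmin P n < n -> P (bmin P n)
    & forall k, k < bmin P n -> ~~ P k].
Proof.
elim: n => [|n [le_n Pn Pk]] //=; case: ifP => [lt_n|/negbT].
  by split=> // [|_]; [exact: ltnW|exact: Pn].
rewrite -leqNgt => ge_n; have E : bmin P n = n by apply/eqP; rewrite eqn_leq le_n.
rewrite E in Pk; case: ifP => Pn'; first by split.
split; rewrite ?ltnn // => k; rewrite ltnS leq_eqVlt => /orP[/eqP->|/Pk//].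
by rewrite Pn'.
Qed.

Lemma bmin_eq (P : pred nat) n k :
  k < n -> P k -> (forall i, i < k -> ~~ P i) -> bmin P n = k.
Proof.
move=> lt_k Pk Pi; have [le_b Pb Pj] := bminP P n.
case: (ltngtP (bmin P n) k) => // [lt|/Pj]; last by rewrite Pk.
by have := Pi _ lt; rewrite Pb // (ltn_trans lt).
Qed.

Lemma bmin_lt (P : pred nat) n : (bmin P n < n) <-> (exists2 k, k < n & P k).
Proof.
split=> [lt|[k lt_k Pk]]; first by exists (bmin P n) => //; case: (bminP P n) lt => _ H _ /H.
rewrite ltnNge; apply/negP => le; have [_ _ /(_ k)] := bminP P n.
by rewrite Pk (leq_trans lt_k le) => /(_ isT).
Qed.

Lemma comp1_bmin (P : nat -> pred nat) n :
  comp1 (fun z => P (pi1 z) (pi2 z) : nat) -> comp1 n ->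
  comp1 (fun x => bmin (P x) (n x)).
Proof.
move=> cP cn.
pose g x k r := if r < k then r else if P x k then k else k.+1.
apply: (@eq_comp1 (fun x => nat_rec (fun=> nat) 0 (g x) (n x))).
  by move=> x; elim: (n x) => //= k ->.
have ck := comp1_pi1 (comp1_pi2 comp1_id); have cr := comp1_pi2 (comp1_pi2 comp1_id).
apply: comp1_nat_rec => //; first exact: comp1_const.
apply: comp1_if; [exact: comp1_leq (comp1S cr) ck|exact: cr|apply: comp1_if].
- apply: eq_comp1 (comp1_subst cP (comp1_npair (comp1_pi1 comp1_id) ck)) => z.
  by rewrite !piK.
- exact: ck.
- exact: comp1S.
Qed.

Arguments bmin : simpl never.

Lemma comp1_odd f : comp1 f -> comp1 (fun x => odd (f x) : nat).
Proof.
move=> cf; have := @comp1_iter f (fun=> 0) (fun _ r => r == 0) cf (comp1_const 0).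
move=> /(_ (comp1_eqn (comp1_pi2 comp1_id) (comp1_const 0))).
apply: eq_comp1 => x; elim: (f x) => //= n ->.
by case: (odd n).
Qed.

Lemma comp1_expn k f : comp1 f -> comp1 (fun x => k ^ f x).
Proof.
move=> cf; have := @comp1_iter f (fun=> 1) (fun _ => muln k) cf (comp1_const 1).
move=> /(_ (comp1_mul (comp1_const k) (comp1_pi2 comp1_id))).
by apply: eq_comp1 => x; elim: (f x) => //= n ->; rewrite expnS.
Qed.

Lemma comp1_dvdn f g : comp1 f -> comp1 g -> comp1 (fun x => f x %| g x : nat).
Proof.
move=> cf cg; have := @comp1_bmin (fun x q => q * f x == g x) (fun x => (g x).+1).
move=> /(_ (comp1_eqn (comp1_mul (comp1_pi2 comp1_id) (comp1_subst cf
  (comp1_pi1 comp1_id))) (comp1_subst cg (comp1_pi1 comp1_id))) (comp1S cg)) cb.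
apply: eq_comp1 (comp1_leq (comp1S cb) (comp1S cg)) => x; congr (nat_of_bool _).
apply/idP/idP => [/bmin_lt[q _ /eqP <-]|]; first exact: dvdn_mull.
case: (posnP (f x)) => [->|f_gt0] Hd.
  by apply/bmin_lt; exists 0 => //; move: Hd; rewrite dvd0n eq_sym.
by apply/bmin_lt; exists (g x %/ f x); rewrite ?ltnS ?leq_div // divnK.
Qed.

(** * Course-of-values recursion *)

Definition hist (f : nat -> nat) (n : nat) : nat :=
  nat_rec (fun=> nat) 0 (fun k r => npair (f k) r) n.

(** A history is a stack with the latest value on top, so the value at [k] lies [n.-1 - k] entries
    deep. *)
Definition lookup (h n k : nat) : nat := pi1 (iter (n.-1 - k) pi2 h).

Lemma lookup_hist f n k : k < n -> lookup (hist f n) n k = f k.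
Proof.
case: n => // n; rewrite ltnS /lookup succnK => le_k.
rewrite -[X in hist f X.+1](subnKC le_k); move: (n - k) => d.
elim: d => [|d IH]; first by rewrite addn0 /= piK.
by rewrite iterSr addnS /= piK.
Qed.

(** The history is built by primitive recursion, since [G] yields the next entry from the earlier
    ones; one more use of [G] gives [f]. *)
Lemma comp1_cov f (G : nat -> nat -> nat) :
  comp1 (fun z => G (pi1 z) (pi2 z)) -> (forall n, f n = G n (hist f n)) ->
  comp1 f.
Proof.
move=> cG fE; have ch : comp1 (hist f).
  have := @comp1_nat_rec id (fun=> 0) (fun _ k r => npair (G k r) r) comp1_id
    (comp1_const 0).
  have ck := comp1_pi1 (comp1_pi2 comp1_id).
  have cr := comp1_pi2 (comp1_pi2 comp1_id).
  move=> /(_ (comp1_npair (eq_comp1 _ (comp1_subst cG (comp1_npair ck cr))) cr)) H.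
  apply: eq_comp1 (H _) => [n|z]; last by rewrite !piK.
  by elim: n => [|n IH] //=; rewrite IH -fE.
apply: eq_comp1 (comp1_subst cG (comp1_npair comp1_id ch)) => n.
by rewrite !piK -fE.
Qed.

Create HintDb comp1.
#[local] Hint Constants Opaque : comp1.
#[local] Hint Resolve comp1_id comp1_const comp1S comp1_pred comp1_add comp1_sub
  comp1_mul comp1_leq comp1_if comp1_neg comp1_and comp1_or comp1_eqn comp1_eqb
  comp1_npair comp1_pi1 comp1_pi2 comp1_nat_rec comp1_iter comp1_bmin comp1_odd
  comp1_expn comp1_dvdn : comp1.

(** * A universal machine *)

(** The successor separates a nonempty list from the empty one, coded by 0. Head and tail of 0 are
    again 0, matching the convention that missing arguments read as 0. *)
Definition lcons (a l : nat) : nat := (npair a l).+1.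
Definition lhead (l : nat) : nat := pi1 l.-1.
Definition ltail (l : nat) : nat := pi2 l.-1.
Definition lnth (i l : nat) : nat := lhead (iter i ltail l).

Arguments lcons : simpl never.
Arguments lhead : simpl never.
Arguments ltail : simpl never.
Arguments lnth : simpl never.

Fixpoint enc_seq (v : seq nat) : nat :=
  if v is a :: v' then lcons a (enc_seq v') else 0.

Lemma lhead_cons a l : lhead (lcons a l) = a.
Proof. exact: pi1K. Qed.

Lemma ltail_cons a l : ltail (lcons a l) = l.
Proof. exact: pi2K. Qed.

Lemma lhead_enc v : lhead (enc_seq v) = head 0 v.
Proof. by case: v => //= a v; rewrite lhead_cons. Qed.

Lemma ltail_enc v : ltail (enc_seq v) = enc_seq (behead v).
Proof. by case: v => //= a v; rewrite ltail_cons. Qed.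

Lemma lnth_enc v i : lnth i (enc_seq v) = nth 0 v i.
Proof.
rewrite /lnth; elim: i v => [|i IH] v; first by rewrite /= lhead_enc nth0.
by rewrite iterSr ltail_enc IH nth_behead.
Qed.

Fixpoint enc (c : recf) : nat :=
  match c with
  | RZero => npair 0 0
  | RSucc => npair 1 0
  | RProj i => npair 2 i
  | RComp f gs => npair 3 (npair (enc f)
      ((fix enc_list (gs : seq recf) : nat :=
        if gs is g :: gs' then lcons (enc g) (enc_list gs') else 0) gs))
  | RPrec f g => npair 4 (npair (enc f) (enc g))
  | RMu f => npair 5 (enc f)
  end.

Fixpoint enc_list (gs : seq recf) : nat :=
  if gs is g :: gs' then lcons (enc g) (enc_list gs') else 0.

(* A machine with a continuation stack [k]: [mEval c v k] evaluates the code
   [c] at [v], [mList gs v k] evaluates a list of codes, and [mRet w k] hands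
   the value [w] to the topmost frame of [k]. *)
Definition mRet (w k : nat) : nat := npair 0 (npair w k).
Definition mEval (c v k : nat) : nat := npair 1 (npair c (npair v k)).
Definition mList (gs v k : nat) : nat := npair 2 (npair gs (npair v k)).

(** The frames record what awaits a value: [fHead] the remaining codes of a list, [fTail] the value
    to be put in front of a list of values, [fCall] the outer code of a composition, [fPrec] a
    recursion whose value at [i] is being computed on the way to [n], [fMu] a search that is testing
    [z]. *)
Definition fHead (gs v : nat) : nat := npair 0 (npair gs v).
Definition fTail (w : nat) : nat := npair 1 w.
Definition fCall (f : nat) : nat := npair 2 f.
Definition fPrec (g i n v : nat) : nat := npair 3 (npair g (npair i (npair n v))).
Definition fMu (f z v : nat) : nat := npair 4 (npair f (npair z v)).

Definition eval_step (c v k : nat) : nat :=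
  let t := pi1 c in let d := pi2 c in
  if t == 0 then mRet 0 k else
  if t == 1 then mRet (lhead v).+1 k else
  if t == 2 then mRet (lnth d v) k else
  if t == 3 then mList (pi2 d) v (lcons (fCall (pi1 d)) k) else
  if t == 4 then
    mEval (pi1 d) (ltail v) (lcons (fPrec (pi2 d) 0 (lhead v) (ltail v)) k)
  else mEval d (lcons 0 v) (lcons (fMu d 0 v) k).

Definition list_step (gs v k : nat) : nat :=
  if gs == 0 then mRet 0 k
  else mEval (lhead gs) v (lcons (fHead (ltail gs) v) k).

Definition ret_step (w k : nat) : nat :=
  let t := pi1 (lhead k) in let d := pi2 (lhead k) in let k' := ltail k in
  if t == 0 then mList (pi1 d) (pi2 d) (lcons (fTail w) k') else
  if t == 1 then mRet (lcons d w) k' else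
  if t == 2 then mEval d w k' else
  if t == 3 then
    let g := pi1 d in let i := pi1 (pi2 d) in
    let n := pi1 (pi2 (pi2 d)) in let v := pi2 (pi2 (pi2 d)) in
    if i == n then mRet w k'
    else mEval g (lcons i (lcons w v)) (lcons (fPrec g i.+1 n v) k')
  else
    let f := pi1 d in let z := pi1 (pi2 d) in let v := pi2 (pi2 d) in
    if w == 0 then mRet z k'
    else mEval f (lcons z.+1 v) (lcons (fMu f z.+1 v) k').

(** A value returned to the empty stack is a fixed point, so a finished computation keeps its
    result. *)
Definition mstep (st : nat) : nat :=
  let t := pi1 st in let d := pi2 st in
  if t == 0 then (if pi2 d == 0 then st else ret_step (pi1 d) (pi2 d)) else
  if t == 1 then eval_step (pi1 d) (pi1 (pi2 d)) (pi2 (pi2 d)) else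
  list_step (pi1 d) (pi1 (pi2 d)) (pi2 (pi2 d)).

Definition reaches (st st' : nat) : Prop := exists t, iter t mstep st = st'.

Lemma reaches_refl st : reaches st st.
Proof. by exists 0. Qed.

Lemma reaches_step st st' : reaches (mstep st) st' -> reaches st st'.
Proof. by move=> [t Ht]; exists t.+1; rewrite iterSr. Qed.

Lemma reaches_trans st st' st'' :
  reaches st st' -> reaches st' st'' -> reaches st st''.
Proof. by move=> [t <-] [t' <-]; exists (t' + t); rewrite iterD. Qed.

Lemma mstep_ret w a k :
  mstep (mRet w (lcons a k)) = ret_step w (lcons a k).
Proof. by rewrite /mstep /mRet !piK. Qed.

Lemma mstep_eval c v k : mstep (mEval c v k) = eval_step c v k.
Proof. by rewrite /mstep /mEval !piK. Qed.

Lemma mstep_list gs v k : mstep (mList gs v k) = list_step gs v k.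
Proof. by rewrite /mstep /mList !piK. Qed.

Lemma mstep_halt w : mstep (mRet w 0) = mRet w 0.
Proof. by rewrite /mstep /mRet !piK. Qed.

Definition machineE := (mstep_ret, mstep_eval, mstep_list, lhead_cons,
  ltail_cons, lhead_enc, ltail_enc, lnth_enc, piK).

Lemma enc_comp f gs : enc (RComp f gs) = npair 3 (npair (enc f) (enc_list gs)).
Proof. by []. Qed.

Lemma enc_prec f g : enc (RPrec f g) = npair 4 (npair (enc f) (enc g)).
Proof. by []. Qed.

Lemma enc_mu f : enc (RMu f) = npair 5 (enc f).
Proof. by []. Qed.

(** Stated for every stack [k], so that each subcomputation can run on top of the frames pending for
    it. *)
Lemma reaches_computes c v y k :
  computes c v y -> reaches (mEval (enc c) (enc_seq v) k) (mRet y k).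
Proof.
elim/recf_nested_ind: c v y k => [v y k ->|v y k ->|i v y k ->|
    f gs IHf IHgs v y k|f g IHf IHg v y k|f IHf v y k].
- by apply: reaches_step; rewrite mstep_eval /eval_step !piK; exact: reaches_refl.
- apply: reaches_step; rewrite mstep_eval /eval_step !piK /= lhead_enc.
  exact: reaches_refl.
- apply: reaches_step; rewrite mstep_eval /eval_step !piK /= lnth_enc.
  exact: reaches_refl.
- move=> /computes_comp[ws Hws fy].
  apply: reaches_step; rewrite mstep_eval enc_comp /eval_step !piK /=.
  have H k' : reaches (mList (enc_list gs) (enc_seq v) k') (mRet (enc_seq ws) k').
    elim: gs IHgs ws Hws k' {fy} => [|g gs IH] /=.
      move=> _ [|//] _ k'.
      by apply: reaches_step; rewrite mstep_list; exact: reaches_refl.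
    move=> [IHg IHgs] [//|w ws] [gw Hws] k'.
    apply: reaches_step; rewrite mstep_list /list_step /= !machineE.
    apply: reaches_trans (IHg _ _ _ gw) _.
    apply: reaches_step; rewrite mstep_ret /ret_step !machineE /=.
    apply: reaches_trans (IH IHgs _ Hws _) _.
    apply: reaches_step; rewrite mstep_ret /ret_step !machineE /=.
    exact: reaches_refl.
  apply: reaches_trans (H _) _.
  by apply: reaches_step; rewrite mstep_ret /ret_step !machineE /=; exact: IHf.
- move=> /computes_prec Hy.
  apply: reaches_step; rewrite mstep_eval enc_prec /eval_step !machineE /=.
  set n := head 0 v in Hy *; set v' := behead v in Hy *.
  have H i z k' : i <= n -> prec_graph f g v' i z ->
      reaches (mEval (enc f) (enc_seq v')
        (lcons (fPrec (enc g) 0 n (enc_seq v')) k'))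
      (mRet z (lcons (fPrec (enc g) i n (enc_seq v')) k')).
    elim: i z => [|i IH] z lt_i /=; first exact: IHf.
    move=> [r Hr gz]; apply: reaches_trans (IH _ (ltnW lt_i) Hr) _.
    apply: reaches_step; rewrite mstep_ret /ret_step !machineE /=.
    by rewrite (ltn_eqF lt_i); exact: (IHg [:: i, r & v']).
  apply: reaches_trans (H _ _ _ (leqnn n) Hy) _.
  apply: reaches_step; rewrite mstep_ret /ret_step !machineE /= eqxx.
  exact: reaches_refl.
- move=> [fy Hz]; apply: reaches_step; rewrite mstep_eval enc_mu /eval_step !piK /=.
  (* The search gets as far as every [z <= y], because each earlier test returns a positive
     value. *)
  have H z k' : z <= y ->
      reaches (mEval (enc f) (lcons 0 (enc_seq v))
        (lcons (fMu (enc f) 0 (enc_seq v)) k'))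
      (mEval (enc f) (lcons z (enc_seq v))
        (lcons (fMu (enc f) z (enc_seq v)) k')).
    elim: z => [_|z IH lt_z]; first exact: reaches_refl.
    apply: reaches_trans (IH (ltnW lt_z)) _; have [w fw] := Hz _ lt_z.
    apply: reaches_trans (IHf (z :: v) _ _ fw) _.
    apply: reaches_step; rewrite mstep_ret /ret_step !machineE /=.
    exact: reaches_refl.
  apply: reaches_trans (H _ _ (leqnn y)) _.
  apply: reaches_trans (IHf (y :: v) _ _ fy) _.
  apply: reaches_step; rewrite mstep_ret /ret_step !machineE /=.
  exact: reaches_refl.
Qed.

(* [ev c v t] is 0 if the machine is still running after [t] steps, and the
   successor of the result otherwise. *)
Definition ev (c v t : nat) : nat :=
  let st := iter t mstep (mEval c v 0) in
  if (pi1 st == 0) && (pi2 (pi2 st) == 0) && (st == mRet (pi1 (pi2 st)) 0)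
  then (pi1 (pi2 st)).+1 else 0.

Lemma ev_halt c v t w : ev c v t = w.+1 <-> iter t mstep (mEval c v 0) = mRet w 0.
Proof.
rewrite /ev; split; last by move=> ->; rewrite /mRet !piK !eqxx.
by case: ifP => // /andP[_ /eqP ->] []; rewrite /mRet !piK => ->.
Qed.

Lemma ev_mono c v t t' w : t <= t' -> ev c v t = w.+1 -> ev c v t' = w.+1.
Proof.
move=> le_t /ev_halt E; apply/ev_halt; rewrite -(subnK le_t) iterD E.
by elim: (t' - t) => //= d ->; exact: mstep_halt.
Qed.

Lemma ev_converges c v y : computes c v y ->
  exists t0, forall t, t0 <= t -> ev (enc c) (enc_seq v) t = y.+1.
Proof.
move=> /(reaches_computes 0)[t0 /ev_halt E]; exists t0 => t le_t.
exact: ev_mono E.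
Qed.

(** A halted machine stays halted, so its result agrees at a late stage with the value that
    [computes] guarantees. *)
Lemma ev_value c v y t w : computes c v y ->
  ev (enc c) (enc_seq v) t = w.+1 -> w = y.
Proof.
move=> /ev_converges[t0 H] E; have := ev_mono (leq_maxl t t0) E.
by rewrite H ?leq_maxr // => -[].
Qed.

Lemma comp1_lcons f g : comp1 f -> comp1 g -> comp1 (fun x => lcons (f x) (g x)).
Proof. rewrite /lcons; auto 50 with comp1. Qed.

Lemma comp1_lhead f : comp1 f -> comp1 (fun x => lhead (f x)).
Proof. rewrite /lhead; auto 50 with comp1. Qed.

Lemma comp1_ltail f : comp1 f -> comp1 (fun x => ltail (f x)).
Proof. rewrite /ltail; auto 50 with comp1. Qed.

#[local] Hint Resolve comp1_lcons comp1_lhead comp1_ltail : comp1.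

Lemma comp1_lnth f g : comp1 f -> comp1 g -> comp1 (fun x => lnth (f x) (g x)).
Proof. rewrite /lnth; auto 50 with comp1. Qed.

#[local] Hint Resolve comp1_lnth : comp1.

Lemma comp1_mstep f : comp1 f -> comp1 (fun x => mstep (f x)).
Proof.
rewrite /mstep /ret_step /list_step /eval_step /mRet /mEval /mList /fHead /fTail.
rewrite /fCall /fPrec /fMu.
auto 100 with comp1.
Qed.

#[local] Hint Resolve comp1_mstep : comp1.

Lemma comp1_ev f g h : comp1 f -> comp1 g -> comp1 h ->
  comp1 (fun x => ev (f x) (g x) (h x)).
Proof. rewrite /ev /mRet /mEval; auto 100 with comp1. Qed.

#[local] Hint Resolve comp1_ev : comp1.

(** * Refinement strategy *)

Definition eventually (P : nat -> Prop) : Prop :=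
  exists s0, forall s, s0 <= s -> P s.

Lemma eventually_and (P Q : nat -> Prop) :
  eventually P -> eventually Q -> eventually (fun s => P s /\ Q s).
Proof.
move=> [s Ps] [t Qt]; exists (maxn s t) => u; rewrite geq_max => /andP[su tu].
by split; [exact: Ps|exact: Qt].
Qed.

Lemma eventually_imp (P Q : nat -> Prop) :
  (forall s, P s -> Q s) -> eventually P -> eventually Q.
Proof. by move=> PQ [s Ps]; exists s => t /Ps/PQ. Qed.

Lemma eventually_forall (P : nat -> nat -> Prop) n :
  (forall i, i < n -> eventually (P i)) ->
  eventually (fun s => forall i, i < n -> P i s).
Proof.
elim: n => [|n IH] H; first by exists 0.
have := eventually_and (IH (fun i lt => H i (leqW lt))) (H n (leqnn _)).
apply: eventually_imp => s [Hi Hn] i; rewrite ltnS leq_eqVlt.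
by case/orP => [/eqP->|/Hi].
Qed.

Lemma monotone_bounded_stabilizes (u : nat -> nat) b :
  (forall s, u s <= u s.+1) -> (forall s, u s <= b) ->
  exists l, eventually (fun s => u s = l).
Proof.
move=> u_le u_b; have u_mono s d : u s <= u (s + d).
  by elim: d => [|d IH]; rewrite ?addn0 // addnS (leq_trans IH).
have : exists l, exists s, l <= u s by exists 0, 0.
pose P l := `[< exists s, l <= u s >].
have exP : exists l, P l by exists 0; apply/asboolP; exists 0.
have Pb l : P l -> l <= b by move=> /asboolP[s /leq_trans]; apply.
case: (ex_maxnP exP Pb) => l /asboolP[s le_l] max_l _; exists l, s => t le_t.
apply/eqP; rewrite eqn_leq max_l /=; last by apply/asboolP; exists t.
by rewrite (leq_trans le_l) // -(subnKC le_t) u_mono.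
Qed.

(* [J s] is the stage [s] guess at a Delta_2 set of blocks and [a j] the number
   of times the strategy has refined block [j].  Scanning the guess in increasing
   order, the counter [cnt] hands to the [i]-th target the task of
   making [a j] of the same parity as [i]; it may only use a block as long as
   [a j + i < j], unless the parity is already right. *)
Fixpoint cnt (S : pred nat) (a : nat -> nat) (j : nat) : nat :=
  if j is k.+1 then
    let i := cnt S a k in
    i + (S k && ((odd (a k) == odd i) || (a k + i < k)))
  else 0.

Fixpoint act (J : nat -> pred nat) (s j : nat) : nat :=
  if s is t.+1 then
    let i := cnt (J t) (act J t) j in
    act J t j + [&& j < t, J t j, odd (act J t j) != odd i & act J t j + i < j]
  else 0.

Lemma actS_leq J s j : act J s j <= act J s.+1 j.
Proof. exact: leq_addr. Qed.

Lemma act_mono J s t j : s <= t -> act J s j <= act J t j.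
Proof.
move=> le_t; rewrite -(subnKC le_t); elim: (t - s) => [|d IH]; rewrite ?addn0 //.
by rewrite addnS (leq_trans IH) ?actS_leq.
Qed.

Lemma act_leq J s j : act J s j <= j.
Proof.
elim: s => //= s IH; case: and4P => [[_ _ _ lt]|_]; last by rewrite addn0.
by rewrite addn1; apply: leq_ltn_trans lt; exact: leq_addr.
Qed.

Lemma cnt_leq S a j : cnt S a j <= j.
Proof. by elim: j => //= j IH; rewrite -[j.+1]addn1 leq_add ?leq_b1. Qed.

Lemma cnt_mono S a j k : j <= k -> cnt S a j <= cnt S a k.
Proof.
move=> le_k; rewrite -(subnKC le_k); elim: (k - j) => [|d IH]; rewrite ?addn0 //.
by rewrite addnS /= (leq_trans IH) ?leq_addr.
Qed.

Lemma eq_cnt S S' a a' j : (forall k, k < j -> S k = S' k) ->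
  (forall k, k < j -> a k = a' k) -> cnt S a j = cnt S' a' j.
Proof.
elim: j => //= j IH eqS eqa; rewrite eqS // eqa // IH //.
  by move=> k lt; apply: eqS; apply: leqW.
by move=> k lt; apply: eqa; apply: leqW.
Qed.

Definition act_lim (J : nat -> pred nat) (j : nat) : nat :=
  xget 0 [set l | eventually (fun s => act J s j = l)].

Lemma act_limP J j : eventually (fun s => act J s j = act_lim J j).
Proof.
have [l Hl] := monotone_bounded_stabilizes (actS_leq J ^~ j) (act_leq J ^~ j).
exact: (@xgetPex _ 0 [set l | eventually (fun s => act J s j = l)]) (ex_intro _ l Hl).
Qed.

(** In the limit the counter is unbounded, and where it passes from [i] to [i + 1] there is a block
    of the limit set whose count has the parity of [i]. Large [i] of either parity give the
    claim. *)
Lemma act_parity_unbounded (J : nat -> pred nat) (Jlim : pred nat) :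
  (forall j, eventually (fun s => J s j = Jlim j)) ->
  (forall b, exists2 j, b <= j & Jlim j) ->
  forall p b, exists j, [/\ b <= j, Jlim j & odd (act_lim J j) = p].
Proof.
move=> Jcv Jinf; pose c := cnt Jlim (act_lim J).
have cS j : c j.+1 = c j + (Jlim j &&
    ((odd (act_lim J j) == odd (c j)) || (act_lim J j + c j < j))) by [].
have ccv n : eventually (fun s => forall j, j < n ->
    [/\ J s j = Jlim j, act J s j = act_lim J j & cnt (J s) (act J s) j = c j]).
  have [s0 H] := eventually_forall
    (fun j (_ : j < n) => eventually_and (Jcv j) (act_limP J j)).
  exists s0 => s /H{}H j lt_j; have [HJ Ha] := H j lt_j; split=> //.
  by apply: eq_cnt => k /ltn_trans/(_ lt_j)/H[].
  (* A fresh block of the limit set stays eligible for the [i]-th task: all other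
   active tasks have larger index and thus leave [act J s j] below [j - i]. *)
have c_unbounded i : exists j, i <= c j.
  elim: i => [|i [j1 le_j1]]; first by exists 0.
  apply: contrapT => /forallNP noj; have c_eq k : j1 <= k -> c k = i.
    move=> le_k; apply/eqP; rewrite eqn_leq (leq_trans le_j1) ?cnt_mono // andbT.
    by rewrite leqNgt; apply/negP/noj.
  have [s0 Hs0] := ccv j1.+1.
  (* Actions on [j] take place only at stages above [j], hence above [s0], when the counter at [j1]
     has already settled at [i]. The bound [i.+1] leaves room for task [i] at the start. *)
  have [j le_j Jj] := Jinf (maxn j1 (maxn s0 i.+1)).
  move: le_j; rewrite !geq_max => /and3P[le_j1j le_s0j lt_ij].
  have inv s : act J s j + i < j \/ act J s j + i = j /\ odd (act J s j) = odd i.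
    elim: s => [|s IH] /=; first by left.
    case: and4P => [[lt_js _ par lt]|_]; last by rewrite addn0.
    have le_i : i <= cnt (J s) (act J s) j.
      have [_ _ E] := Hs0 s (ltnW (leq_ltn_trans le_s0j lt_js)) j1 (leqnn _).
      by rewrite -(c_eq _ (leqnn j1)) -E cnt_mono.
    rewrite addn1 addSn; move: lt par.
    case: (ltngtP i (cnt (J s) (act J s) j)) le_i => // [lt_i _ lt _|<- _ lt par].
      by left; rewrite -addnS; apply: leq_ltn_trans lt; rewrite leq_add2l.
    case: (ltngtP (act J s j + i).+1 j) lt => // [|E] _; first by left.
    by right; split=> //=; move: par; case: (odd _); case: (odd _).
  have elig : odd (act_lim J j) == odd i \/ act_lim J j + i < j.
    have [s1 Hs1] := act_limP J j; rewrite -(Hs1 _ (leqnn _)).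
    by case: (inv s1) => [|[_ ->]]; [right|left].
  have := c_eq _ (leqW le_j1j); rewrite cS (c_eq _ le_j1j) Jj /=.
  by case: elig => ->; rewrite ?orbT addn1 => /eqP; rewrite gtn_eqF.
have c_step i : exists j, [/\ c j = i, Jlim j & odd (act_lim J j) = odd i].
  have exj : exists j, i < c j by exact: c_unbounded.
  have [[|j] lt_ij min_j] := ex_minnP exj => //.
  have ci : c j = i.
    apply/eqP; rewrite eqn_leq; apply/andP; split.
      by rewrite leqNgt; apply/negP => /min_j; rewrite ltnn.
    rewrite -ltnS (leq_trans lt_ij) // cS -[(c j).+1]addn1 leq_add2l.
    exact: leq_b1.
  move: lt_ij; rewrite cS ci; case Jj: (Jlim j); last by rewrite addn0 ltnn.
  case: eqP => [par _|/eqP par /= lt]; first by exists j.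
  (* With the wrong parity, the counter can only have moved because room is left; but then the
     strategy acts on [j] once more after its count has settled. *)
  have {}lt : act_lim J j + i < j by move: lt; case: (_ < j); rewrite ?addn0 ?ltnn.
  have [s0 H0] := ccv j.+1; have [s1 H1] := act_limP J j.
  pose s := maxn j.+1 (maxn s0 s1).
  have [js s0s s1s] : [/\ j < s, s0 <= s & s1 <= s].
    by rewrite /s !leq_max !leqnn !orbT.
  have [EJ Ea Ec] := H0 s s0s j (leqnn _); have := H1 s.+1 (leqW s1s).
  rewrite /= Ec ci Ea EJ Jj js par lt /= addn1 => /eqP.
  by rewrite gtn_eqF.
(* The index [b.*2 + p] has parity [p] and is at least [b]; the block serving it is no smaller,
   because the counter at [j] is at most [j]. *)
move=> p b; have [j [ci Jj par]] := c_step (b.*2 + p).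
exists j; split=> //; last by rewrite par oddD odd_double oddb.
have := cnt_leq Jlim (act_lim J) j; rewrite -/(c j) ci; apply: leq_trans.
by rewrite -addnn -addnA leq_addr.
Qed.

(** * Approximation of Delta_2 sets *)

(** [act] at a stage calls [act] and [cnt] at the previous stage, and [cnt] calls both at the
    preceding block. The pair of values is therefore computed by one course-of-values recursion over
    the code of strategy, block and stage. *)
Lemma comp1_act (J : nat -> nat -> pred nat) f g h :
  comp1 (fun z => J (pi1 z) (pi1 (pi2 z)) (pi2 (pi2 z)) : nat) ->
  comp1 f -> comp1 g -> comp1 h -> comp1 (fun x => act (J (f x)) (g x) (h x)).
Proof.
move=> cJ cf cg ch.
have cJ' u v w : comp1 u -> comp1 v -> comp1 w ->
    comp1 (fun x => J (u x) (v x) (w x) : nat).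
  move=> cu cv cw.
  apply: eq_comp1 (comp1_subst cJ (comp1_npair cu (comp1_npair cv cw))) => x.
  by rewrite !piK.
pose F x := let e := pi1 x in let j := pi1 (pi2 x) in let s := pi2 (pi2 x) in
  npair (act (J e) s j) (cnt (J e s) (act (J e) s) j).
suff cF : comp1 F.
  have := comp1_pi1 (comp1_subst cF (comp1_npair cf (comp1_npair ch cg))).
  by apply: eq_comp1 => x; rewrite /F !piK.
pose G x k :=
  let e := pi1 x in let j := pi1 (pi2 x) in let s := pi2 (pi2 x) in
  let r := lookup k x (npair e (npair j s.-1)) in
  let r' := lookup k x (npair e (npair j.-1 s)) in
  npair
    (if s == 0 then 0 else pi1 r +
      [&& j < s.-1, J e s.-1 j, odd (pi1 r) != odd (pi2 r) & pi1 r + pi2 r < j])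
    (if j == 0 then 0 else pi2 r' + (J e s j.-1 &&
      ((odd (pi1 r') == odd (pi2 r')) || (pi1 r' + pi2 r' < j.-1)))).
apply: (@comp1_cov _ G).
  by rewrite /G /lookup; auto 100 with comp1.
have le3 x : npair (pi1 x) (npair (pi1 (pi2 x)) (pi2 (pi2 x))) <= x.
  apply: leq_trans (pair_pi_leq x); have := pair_pi_leq (pi2 x).
  rewrite leq_eqVlt => /predU1P[->//|lt]; apply: ltnW.
  by rewrite ltn_npair ?lt ?orbT // ltnW.
move=> x; rewrite /F /G; set e := pi1 x; set j := pi1 _; set s := pi2 _.
congr npair.
  case: eqP => [->//|/eqP s_gt0]; rewrite lookup_hist; last first.
    apply: leq_trans (le3 x); apply: ltn_npair => //.
      by rewrite ltnW // ltn_npair ?leq_pred // prednK ?leqnn ?orbT ?lt0n.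
    by rewrite ltn_npair ?leq_pred ?orbT // prednK ?leqnn ?orbT ?lt0n.
  by rewrite /F !piK; case: (s) s_gt0.
case: eqP => [->//|/eqP j_gt0]; rewrite lookup_hist; last first.
  apply: leq_trans (le3 x); apply: ltn_npair => //.
    by rewrite ltnW // ltn_npair ?leq_pred // prednK ?leqnn ?orbT ?lt0n.
  by rewrite ltn_npair ?leq_pred ?orbT // prednK ?leqnn ?orbT ?lt0n.
by rewrite /F !piK; case: (j) j_gt0.
Qed.

(** Some [y <= s] is seen within [s] steps to give the relation the truth value [b]: false refutes a
    universal statement about the relation, true one about its negation. *)
Definition refuted (c n x s : nat) (b : bool) : bool :=
  bmin (fun y => ev c (enc_seq [:: n; x; y]) s == b.+1) s.+1 < s.+1.

Lemma refuted_sound R c n x s b :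
  (forall n x y, computes c [:: n; x; y] (R n x y : bool)) ->
  refuted (enc c) n x s b -> exists y, R n x y = b.
Proof.
move=> Hc /bmin_lt[y _ /eqP /(ev_value (Hc n x y)) E]; exists y.
by move: E; case: b; case: (R n x y).
Qed.

Lemma refuted_complete R c n x y b :
  (forall n x y, computes c [:: n; x; y] (R n x y : bool)) ->
  R n x y = b -> eventually (fun s => refuted (enc c) n x s b).
Proof.
move=> Hc Rb; have [t Ht] := ev_converges (Hc n x y).
exists (maxn t y) => s; rewrite geq_max => /andP[ts ys].
by apply/bmin_lt; exists y; rewrite ?ltnS // Ht // Rb.
Qed.

(* The [x] found is the least one that is not yet refuted as a Sigma_2 witness
   either of [n \in A] (via [p]) or of [n \notin A] (via [q]). *)
Definition approx (p q n s : nat) : bool :=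
  let x := bmin (fun x => ~~ refuted p n x s false || ~~ refuted q n x s true) s.+1
  in ~~ refuted p n x s false.

(** Whichever of [A n] and its negation is true has a Sigma_2 witness. All candidates below the
    least witness [x] are eventually refuted on both sides, and at [x] only the false side is. *)
Lemma Delta2_approx (A : set nat) : Delta2 A ->
  exists p q, forall n, eventually (fun s => approx p q n s = `[< A n >]).
Proof.
move=> [[R [c Hc] AR] [R' [c' Hc'] AR']]; exists (enc c), (enc c') => n.
have An1 : A n <-> exists x, forall y, R n x y by rewrite AR.
have An2 : A n <-> forall x, exists y, R' n x y by rewrite AR'.
pose P x := `[< (forall y, R n x y) \/ (forall y, ~~ R' n x y) >].
have exP : exists x, P x.
  have [An|nAn] := pselect (A n).
    by have [x Rx] := An1.1 An; exists x; apply/asboolP; left.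
  have /existsNP[x /forallNP Rx] : ~ forall x, exists y, R' n x y by move/An2.
  by exists x; apply/asboolP; right=> y; apply/negP/Rx.
have [x /asboolP Px min_x] := ex_minnP exP.
have refR z : ~ (forall y, R n z y) ->
    eventually (fun s => refuted (enc c) n z s false).
  by move=> /existsNP[y /negP/negbTE]; exact: refuted_complete.
have refR' z : ~ (forall y, ~~ R' n z y) ->
    eventually (fun s => refuted (enc c') n z s true).
  by move=> /existsNP[y /negP/negPn]; exact: refuted_complete.
have ref_lt : eventually (fun s => forall z, z < x ->
    refuted (enc c) n z s false /\ refuted (enc c') n z s true).
  apply: eventually_forall => z lt_z.
  have /asboolPn/not_orP[nR nR'] : ~~ P z.
    by apply/negP => /min_x; rewrite leqNgt lt_z.
  by apply: eventually_and; [exact: refR|exact: refR'].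
have ref_x : eventually (fun s =>
    (~~ refuted (enc c) n x s false || ~~ refuted (enc c') n x s true) /\
    ~~ refuted (enc c) n x s false = `[< A n >]).
  have [An|nAn] := pselect (A n).
    exists 0 => s _; suff nref : ~~ refuted (enc c) n x s false.
      by rewrite nref; split=> //; symmetry; apply/asboolP.
    apply/negP => /(refuted_sound Hc)[y Ry].
    case: Px => [/(_ y)|]; first by rewrite Ry.
    by have [z Rz] := An2.1 An x; move/(_ z); rewrite Rz.
  have nR : ~ (forall y, R n x y) by move=> Rx; apply: nAn; apply/An1; exists x.
  apply: eventually_imp (refR _ nR) => s -> /=; split; last first.
    by symmetry; apply/asboolPn.
  apply/negP => /(refuted_sound Hc')[y Ry].
  by case: Px => [//|/(_ y)]; rewrite Ry.
have [s0 H] := eventually_and ref_lt ref_x; exists (maxn s0 x) => s.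
rewrite geq_max => /andP[/H[lt_x [Hx E]] le_x].
rewrite /approx (@bmin_eq _ s.+1 x) // => z /lt_x[-> ->] //.
Qed.

(* [e] packs a bound [b], a code for a partial function [f] and the two codes of
   an approximation of [A]: the guess is that [j] is the value of [f] at the
   first [n >= b] in [A] with [f n >= j]. *)
Definition guess (e s j : nat) : bool :=
  let b := pi1 e in let c := pi1 (pi2 e) in
  let p := pi1 (pi2 (pi2 e)) in let q := pi2 (pi2 (pi2 e)) in
  let n := bmin (fun n =>
    [&& b <= n, approx p q n s & j < ev c (enc_seq [:: n]) s]) s.+1 in
  ev c (enc_seq [:: n]) s == j.+1.

(** The values of [f] on [A] are thinned out to those [j] that occur at the first place where the
    value is at least [j]. They are still infinitely many, and the guesses converge because that
    first place is eventually found. *)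
Lemma guess_converges (A : set nat) (f : nat -> option nat) c p q b :
  (forall n, eventually (fun s => approx p q n s = `[< A n >])) ->
  (forall n y, f n = Some y <-> computes c [:: n] y) ->
  (forall n, b <= n -> A n -> exists y, f n = Some y) ->
  (forall j, exists n y, [/\ b <= n, A n, f n = Some y & j <= y]) ->
  exists Jlim : pred nat,
    [/\ forall j, eventually (fun s =>
          guess (npair b (npair (enc c) (npair p q))) s j = Jlim j),
        forall j, exists2 k, j <= k & Jlim k
      & forall j, Jlim j -> exists n, [/\ b <= n, A n & f n = Some j]].
Proof.
move=> Aapp fc fdef funb.
pose N j n := `[< [/\ b <= n, A n & exists2 y, f n = Some y & j <= y] >].
have exN j : exists n, N j n.
  by have [n [y [bn An fn jy]]] := funb j; exists n; apply/asboolP; split=> //; exists y.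
pose n0 j := ex_minn (exN j).
exists (fun j => f (n0 j) == Some j); split.
- move=> j; rewrite /n0; case: (ex_minnP (exN j)) => n Nn min_n.
  have /asboolP[bn An [y fn jy]] := Nn.
  have evn : eventually (fun s => ev (enc c) (enc_seq [:: n]) s = y.+1).
    by apply/ev_converges/fc.
  have lt_n : eventually (fun s => forall k, k < n ->
      ~~ [&& b <= k, approx p q k s & j < ev (enc c) (enc_seq [:: k]) s]).
    apply: eventually_forall => k lt_k.
    case: (leqP b k) => [bk|_]; last by exists 0.
    apply: eventually_imp (Aapp k) => s -> /=.
    case: asboolP => //= Ak; have [z fk] := fdef _ bk Ak.
    apply/negP => lt_j; have nN : ~~ N j k by apply/negP => /min_n; rewrite leqNgt lt_k.
    move/asboolPn: nN; apply; split=> //; exists z => //.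
    case E : (ev _ _ _) lt_j => [//|w]; rewrite ltnS.
    by rewrite (ev_value ((fc k z).1 fk) E).
  have [s0 H] := eventually_and evn (eventually_and lt_n (Aapp n)).
  exists (maxn s0 n) => s; rewrite geq_max => /andP[/H[En [Hlt Hn]] le_n].
  rewrite /guess !piK (@bmin_eq _ s.+1 n) //.
    by rewrite En fn eqSS; apply/eqP/eqP => [->|[->]].
  by rewrite bn Hn En ltnS jy andbT; apply/asboolP.
- move=> j; rewrite /n0.
  have := ex_minnP (exN j) => -[n /asboolP[bn An [k fn jk]] min_n]; exists k => //.
  case: (ex_minnP (exN k)) => n' /asboolP[bn' An' [y fn' ky]] min_n'.
  (* The first place with value at least [j] has value [k], so it is also the first with value at
     least [k]. *)
  suff -> : n' = n by rewrite fn.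
  apply/eqP; rewrite eqn_leq min_n' ?min_n //; apply/asboolP; split=> //.
    by exists y => //; exact: leq_trans ky.
  by exists k.
- move=> j /eqP; rewrite /n0; case: (ex_minnP (exN j)) => n /asboolP[bn An _] _ fn.
  by exists n.
Qed.

Lemma comp1_guess f g h : comp1 f -> comp1 g -> comp1 h ->
  comp1 (fun x => guess (f x) (g x) (h x) : nat).
Proof.
move=> cf cg ch; suff c : comp1 (fun z =>
    guess (pi1 z) (pi1 (pi2 z)) (pi2 (pi2 z)) : nat).
  have := comp1_subst c (comp1_npair cf (comp1_npair cg ch)).
  by apply: eq_comp1 => x; rewrite !piK.
by rewrite /guess /approx /refuted /=; auto 100 with comp1.
Qed.

(** * The linear order *)

(** Every number [e] codes a strategy, which counts on the blocks [j > e] only; so block [j] is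
    refined at most [j] times for each of its [j] strategies. *)
Definition refine (s j : nat) : nat := \sum_(e < j) act (guess e) s j.

Lemma refine_mono s t j : s <= t -> refine s j <= refine t j.
Proof. by move=> le_t; apply: leq_sum => e _; exact: act_mono. Qed.

Lemma refine_leq s j : refine s j <= j * j.
Proof.
rewrite -[X in X * _]card_ord -sum_nat_const.
by apply: leq_sum => e _; exact: act_leq.
Qed.

(** A sum of nondecreasing counts that has stopped growing has stopped in every summand. *)
Lemma refine_stable s j e : (forall t, refine t j <= refine s j) -> e < j ->
  act (guess e) s j = act_lim (guess e) j.
Proof.
move=> stab lt_e; have [t0 Ht] := act_limP (guess e) j.
pose t := maxn s t0; rewrite -(Ht t (leq_maxr _ _)).
have le_t := act_mono (guess e) j (leq_maxl s t0).
apply/eqP; rewrite eqn_leq le_t leqNgt; apply/negP => lt.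
have := stab t; rewrite leqNgt /refine.
rewrite (bigD1 (Ordinal lt_e)) //= [X in _ < X](bigD1 (Ordinal lt_e)) //=.
rewrite -addSn leq_add //; apply: leq_sum => i _.
by apply: act_mono; exact: leq_maxl.
Qed.

(* Block [j] consists of the points [i < 2 ^ (j * j)] that are multiples of
   [mesh s j] for some stage [s]. *)
Definition mesh (s j : nat) : nat := 2 ^ (j * j - refine s j).

Lemma mesh_dvd s t j : s <= t -> mesh t j %| mesh s j.
Proof. by move=> le_t; rewrite dvdn_exp2l // leq_sub2l // refine_mono. Qed.

Lemma mesh_gt0 s j : 0 < mesh s j.
Proof. by rewrite expn_gt0. Qed.

Definition label (j i s : nat) : nat := npair (npair j i) s.
Definition blk (x : nat) : nat := pi1 (pi1 x).
Definition idx (x : nat) : nat := pi2 (pi1 x).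
Definition stg (x : nat) : nat := pi2 x.

Lemma blk_label j i s : blk (label j i s) = j.
Proof. by rewrite /blk !piK. Qed.
Lemma idx_label j i s : idx (label j i s) = i.
Proof. by rewrite /idx !piK. Qed.
Lemma stg_label j i s : stg (label j i s) = s.
Proof. by rewrite /stg !piK. Qed.

Definition labelK := (blk_label, idx_label, stg_label).

(* The stage recorded in a label is the first one at which its point appears. *)
Definition inL (x : nat) : bool :=
  [&& x == label (blk x) (idx x) (stg x),
      idx x < 2 ^ (blk x * blk x),
      mesh (stg x) (blk x) %| idx x
    & (stg x == 0) || ~~ (mesh (stg x).-1 (blk x) %| idx x)].

Definition ltL (x y : nat) : bool :=
  [&& inL x, inL y & (blk x < blk y) || (blk x == blk y) && (idx x < idx y)].

Lemma inL_inj x y : inL x -> inL y -> blk x = blk y -> idx x = idx y -> x = y.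
Proof.
suff H u v : inL u -> inL v -> blk u = blk v -> idx u = idx v -> stg u <= stg v.
  move=> Lx Ly Eb Ei; have Es : stg x = stg y.
    by apply/eqP; rewrite eqn_leq !H.
  by move/and4P: Lx => [/eqP-> _ _ _]; move/and4P: Ly => [/eqP-> _ _ _]; congr label.
move=> /and4P[_ _ _ nu] /and4P[_ _ dv _] Eb Ei; rewrite leqNgt; apply/negP => lt.
move: nu; rewrite gtn_eqF ?(leq_ltn_trans _ lt) //= Eb Ei => /negP; apply.
apply: dvdn_trans dv; apply: mesh_dvd; rewrite -ltnS prednK //.
exact: leq_ltn_trans lt.
Qed.

Lemma inL_exists j i s : i < 2 ^ (j * j) -> mesh s j %| i ->
  exists t, inL (label j i t).
Proof.
move=> lt_i ds; have exd : exists s, mesh s j %| i by exists s.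
have [t dt min_t] := ex_minnP exd; exists t; rewrite /inL !labelK eqxx lt_i dt /=.
case: t dt min_t => //= t _ min_t; apply/negP => /min_t.
by rewrite ltnn.
Qed.

Lemma inL_first j : inL (label j 0 0).
Proof. by rewrite /inL !labelK !eqxx expn_gt0 dvdn0. Qed.

Lemma ltL_blk x y : inL x -> inL y -> blk x < blk y -> ltL x y.
Proof. by move=> Lx Ly lt; rewrite /ltL Lx Ly lt. Qed.

Lemma ltL_trans x y z : ltL x y -> ltL y z -> ltL x z.
Proof.
move=> /and3P[Lx Ly xy] /and3P[_ Lz yz]; rewrite /ltL Lx Lz /=.
case/orP: xy => [xy|/andP[/eqP-> xy]]; case/orP: yz => [yz|/andP[/eqP E yz]].
- by rewrite (ltn_trans xy yz).
- by rewrite -E xy.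
- by rewrite yz.
- by rewrite E eqxx (ltn_trans xy yz) orbT.
Qed.

Lemma ltL_irr x : ~~ ltL x x.
Proof. by rewrite /ltL !ltnn andbF !andbF. Qed.

Lemma ltL_dom x y : ltL x y -> inL x /\ inL y.
Proof. by case/and3P. Qed.

Lemma ltL_total x y : inL x -> inL y -> [\/ ltL x y, x = y | ltL y x].
Proof.
move=> Lx Ly; rewrite /ltL Lx Ly /= [blk y == _]eq_sym.
case: (ltngtP (blk x) (blk y)) => [lt|lt|E]; first by constructor 1.
  by constructor 3.
case: (ltngtP (idx x) (idx y)) => [lt|lt|E'].
- by constructor 1.
- by constructor 3.
- by constructor 2; exact: inL_inj.
Qed.

Lemma dvdn_next d a b : d %| a -> d %| b -> a < b -> a + d <= b.
Proof.
move=> /dvdnP[p ->] /dvdnP[q ->] lt; rewrite -mulSnr leq_mul2r.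
by move: lt; rewrite ltn_mul2r => /andP[_ ->]; rewrite orbT.
Qed.

(* A refinement of a block separates every point of the block from its successor,
   even when the successor is the first point of the next block. *)
Lemma refine_between x y t : ltL x y ->
  refine (maxn (stg x) (stg y)) (blk x) < refine t (blk x) ->
  exists z, ltL x z && ltL z y.
Proof.
set s := maxn _ _; move=> xy lt_r; have := xy.
move=> /and3P[Lx Ly lt_xy]; have [/and4P[_ ix dx _] /and4P[_ iy dy _]] := (Lx, Ly).
have le_t : s <= t.
  by rewrite ltnW // ltnNge; apply/negP => /(refine_mono (blk x)); rewrite leqNgt lt_r.
(* The new point follows [x] at the distance of the finer mesh. Multiples of the coarse mesh beyond
   [idx x], among them the end of the block, lie further away. *)
pose i := idx x + mesh t (blk x).
have lt_mesh : mesh t (blk x) < mesh s (blk x).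
  rewrite ltn_exp2l // ltn_sub2l //; exact: leq_trans lt_r (refine_leq _ _).
have ds : mesh s (blk x) %| idx x by apply: dvdn_trans dx; rewrite mesh_dvd ?leq_maxl.
have lt_i k : mesh s (blk x) %| k -> idx x < k -> i < k.
  by move=> dk lt_k; apply: leq_trans (dvdn_next ds dk lt_k); rewrite ltn_add2l.
have i_lt : i < 2 ^ (blk x * blk x) by apply: lt_i => //; rewrite dvdn_exp2l ?leq_subr.
have di : mesh t (blk x) %| i.
  by rewrite dvdn_addl // (dvdn_trans _ ds) ?mesh_dvd.
have [u Lz] := inL_exists i_lt di; exists (label (blk x) i u).
rewrite /ltL Lx Ly Lz !labelK eqxx -[X in X < i]addn0 ltn_add2l mesh_gt0 orbT /=.
case/orP: lt_xy => [->//|/andP[/eqP E lt_xy]]; rewrite E ltnn eqxx /=.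
apply: lt_i lt_xy; apply: dvdn_trans dy; rewrite -E.
by rewrite mesh_dvd ?leq_maxr.
Qed.

Lemma comp1_refine f g : comp1 f -> comp1 g -> comp1 (fun x => refine (f x) (g x)).
Proof.
move=> cf cg; pose h x (e r : nat) := r + act (guess e) (f x) (g x).
apply: (@eq_comp1 (fun x => nat_rec (fun=> nat) 0 (h x) (g x))).
  move=> x; rewrite /refine.
  have recE F n : nat_rec (fun=> nat) 0 (fun e r => r + F e) n = \sum_(e < n) F e.
    by elim: n => [|n /= ->]; rewrite ?big_ord0 // big_ord_recr.
  exact: recE.
apply: comp1_nat_rec => //; first exact: comp1_const.
apply: comp1_add; first by auto with comp1.
apply: comp1_act; [|auto with comp1|exact: comp1_subst cf (comp1_pi1 comp1_id)|
  exact: comp1_subst cg (comp1_pi1 comp1_id)].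
by apply: comp1_guess; auto 10 with comp1.
Qed.

Lemma comp1_inL f : comp1 f -> comp1 (fun x => inL (f x) : nat).
Proof.
move=> cf; have cm g h : comp1 g -> comp1 h -> comp1 (fun x => mesh (g x) (h x)).
  by move=> cg ch; apply/comp1_expn/comp1_sub;
    [auto with comp1|exact: comp1_refine].
by rewrite /inL /label /blk /idx /stg; auto 100 with comp1.
Qed.

Lemma comp1_ltL f g : comp1 f -> comp1 g -> comp1 (fun x => ltL (f x) (g x) : nat).
Proof.
move=> cf cg; have := comp1_inL cf; have := comp1_inL cg.
by rewrite /ltL /blk /idx; auto 50 with comp1.
Qed.

Lemma computable_set_comp1 (A : pred nat) :
  comp1 (fun x => A x : nat) -> computable_set A.
Proof. by []. Qed.

Lemma computable_rel2_comp1 (R : nat -> nat -> bool) :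
  comp1 (fun z => R (pi1 z) (pi2 z) : nat) -> computable_rel2 R.
Proof.
move=> [c Hc]; have [d Hd] : compv (fun v => npair (nth 0 v 0) (nth 0 v 1)).
  have cs := compv_add (compv_nth 0) (compv_nth 1).
  exact: compv_add (compv_mul cs cs) (compv_nth 0).
exists (RComp c [:: d]) => m n; apply/computes_comp; exists [:: npair m n].
  by split=> //; exact: (Hd [:: m; n]).
by have := Hc (npair m n); rewrite !piK.
Qed.

Lemma ltL_computable : computable_rel2 ltL.
Proof. by apply: computable_rel2_comp1; apply: comp1_ltL; auto with comp1. Qed.

Definition denseL : computable_linear_order :=
  @ComputableLinearOrder inL ltL (ex_intro (fun n => inL n) _ (inL_first 0))
    (computable_set_comp1 (comp1_inL comp1_id)) ltL_computable
    ltL_dom ltL_irr ltL_trans ltL_total.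

(** * The order type of the linear order *)

Lemma order_iso_surj (A B : Type) (ltA : A -> A -> Prop) (ltB : B -> B -> Prop)
    (f : A -> B) :
  (forall x y, [\/ ltA x y, x = y | ltA y x]) ->
  (forall x, ~ ltB x x) -> (forall x y z, ltB x y -> ltB y z -> ltB x z) ->
  (forall x y, ltA x y -> ltB (f x) (f y)) ->
  (forall b, exists a, f a = b) -> order_iso ltA ltB.
Proof.
move=> tot irr tr mono surj; exists f.
  have [g gK] := choice surj.
  exists g => // x; have [lt|//|lt] := tot (g (f x)) x.
    by have := mono _ _ lt; rewrite gK => /irr.
  by have := mono _ _ lt; rewrite gK => /irr.
move=> x y; split; first exact: mono.
move=> lt; case: (tot x y) => [//|E|/mono lt']; first by rewrite E in lt; case: (irr _ lt).
by case: (irr _ (tr _ _ _ lt lt')).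
Qed.

(** The rank of a point is the number of occupied positions below it; this closes the gaps in the
    range of [pos]. *)
Lemma order_iso_omega (A : Type) (lt : A -> A -> Prop) (pos : A -> nat) :
  (forall x y, [\/ lt x y, x = y | lt y x]) ->
  (forall x y, lt x y -> pos x < pos y) ->
  (forall n, exists x, n <= pos x) -> order_iso lt omega_lt.
Proof.
move=> tot mono unb; pose P k := `[< exists x, pos x = k >].
pose rk n := count P (iota 0 n).
have rkS n : rk n.+1 = rk n + P n by rewrite /rk -addn1 iotaD count_cat /= addn0.
have rk_mono m n : m <= n -> rk m <= rk n.
  by move=> le; rewrite /rk -(subnKC le) iotaD count_cat leq_addr.
have Ppos x : P (pos x) by apply/asboolP; exists x.
apply: (@order_iso_surj _ _ _ _ (fun x => rk (pos x))) => //.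
- by move=> x; rewrite /omega_lt ltnn.
- by move=> x y z; exact: ltn_trans.
- by move=> x y /mono lt_xy; apply: leq_trans (rk_mono _ _ lt_xy); rewrite rkS Ppos addn1.
move=> k; have exk : exists n, k < rk n.
  elim: k => [|k [n lt_n]].
    by have [x _] := unb 0; exists (pos x).+1; rewrite rkS Ppos addn1.
  have [x le_x] := unb n; exists (pos x).+1; rewrite rkS Ppos addn1 ltnS.
  by apply: leq_trans lt_n _; exact: rk_mono.
have [[|n] lt_n min_n] := ex_minnP exk => //.
have le_k : rk n <= k by rewrite leqNgt; apply/negP => /min_n; rewrite ltnn.
move: lt_n; rewrite rkS; case Pn: (P n); last by rewrite addn0 ltnNge le_k.
rewrite addn1 ltnS => le_n; have /asboolP[x xn] := Pn.
by exists x; apply/eqP; rewrite xn eqn_leq le_k.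
Qed.

Lemma denseL_omega : computable_copy_of_omega denseL.
Proof.
pose off j := \sum_(k < j) 2 ^ (k * k).
have off_mono j k : j < k -> off j + 2 ^ (j * j) <= off k.
  move=> lt; rewrite /off -(subnKC lt).
  rewrite big_split_ord /= big_ord_recr /= leq_addr //.
pose pos (x : {n | inL n}) := off (blk (val x)) + idx (val x).
apply: (@order_iso_omega _ _ pos) => [x y|x y|n].
- have [lt|E|lt] := ltL_total (valP x) (valP y).
  + by constructor 1.
  + by constructor 2; exact: val_inj.
  + by constructor 3.
- rewrite /pos => /and3P[/and4P[_ ix _ _] _ /orP[lt|/andP[/eqP-> lt]]].
    apply: leq_trans (_ : off (blk (val y)) <= _); last exact: leq_addr.
    apply: leq_trans (off_mono _ _ lt).
    by rewrite ltn_add2l.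
  by rewrite ltn_add2l.
- exists (exist (fun k => inL k) _ (inL_first n)); rewrite /pos /= !labelK addn0.
  rewrite /off -[X in X <= _]card_ord -sum1_card; apply: leq_sum => k _.
  by rewrite expn_gt0.
Qed.

(** * Countable dense orders *)

Definition dense_order (A : Type) (lt : A -> A -> Prop) : Prop :=
  [/\ forall x, ~ lt x x,
      forall x y z, lt x y -> lt y z -> lt x z,
      forall x y, [\/ lt x y, x = y | lt y x],
      forall x y, lt x y -> exists z, lt x z /\ lt z y
    & forall x, (exists y, lt x y) /\ (exists y, lt y x)].

Lemma dense_order_flip (A : Type) (lt : A -> A -> Prop) :
  dense_order lt -> dense_order (fun x y => lt y x).
Proof.
move=> [irr tr tot den noend]; split=> // [x y z yx zy|x y|x y yx|x].
- exact: tr zy yx.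
- by case: (tot x y); [constructor 3|constructor 2|constructor 1].
- by have [z [yz zx]] := den _ _ yx; exists z.
- by have [] := noend x.
Qed.

Lemma dense_order_max (A : eqType) (lt : A -> A -> Prop) (s : seq A) x :
  dense_order lt -> exists2 m, m \in x :: s & forall y, y \in x :: s -> y = m \/ lt y m.
Proof.
move=> [_ tr tot _ _]; elim: s x => [|y s IH] x.
  by exists x; rewrite ?mem_head // => y; rewrite inE => /eqP; left.
have [m m_in max_m] := IH y; case: (tot x m) => [xm|xm|mx].
- exists m; first by rewrite inE m_in orbT.
  by move=> z; rewrite inE => /orP[/eqP->|/max_m//]; right.
- exists m; first by rewrite inE m_in orbT.
  by move=> z; rewrite inE => /orP[/eqP->|/max_m//]; left.
- exists x; rewrite ?mem_head // => z; rewrite inE => /orP[/eqP->|/max_m[->|zm]];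
    [by left|by right|right; exact: tr zm mx].
Qed.

(** Density gives a point between the greatest element of [lo] and the least one of [hi]; if exactly
    one list is empty, the absence of endpoints does. *)
Lemma dense_order_cut (A : eqType) (lt : A -> A -> Prop) (lo hi : seq A) :
  inhabited A -> dense_order lt ->
  (forall x y, x \in lo -> y \in hi -> lt x y) ->
  exists z, (forall x, x \in lo -> lt x z) /\ (forall y, y \in hi -> lt z y).
Proof.
move=> [a] dlo; have [irr tr tot den noend] := dlo => cut.
have below m s z : (forall y, y \in s -> y = m \/ lt y m) -> lt m z ->
    forall y, y \in s -> lt y z.
  by move=> max_m mz y /max_m[->//|ym]; exact: tr ym mz.
have above m s z : (forall y, y \in s -> y = m \/ lt m y) -> lt z m ->
    forall y, y \in s -> lt z y.
  by move=> min_m zm y /min_m[->//|ym]; exact: tr zm ym.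
case: lo cut => [|x lo] cut.
  case: hi cut => [|y hi] cut; first by exists a; split.
  have [m _ min_m] := dense_order_max hi y (dense_order_flip dlo).
  have [_ [z zm]] := noend m; exists z; split=> //; exact: above min_m zm.
have [m m_in max_m] := dense_order_max lo x dlo.
case: hi cut => [|y hi] cut.
  have [[z mz] _] := noend m; exists z; split=> //; exact: below max_m mz.
have [m' m'_in min_m] := dense_order_max hi y (dense_order_flip dlo).
have [z [mz zm']] := den _ _ (cut _ _ m_in m'_in).
by exists z; split; [exact: below max_m mz|exact: above min_m zm'].
Qed.

(** * Finite partial isomorphisms and back-and-forth *)

Definition partial_iso (A B : eqType) (ltA : A -> A -> Prop) (ltB : B -> B -> Prop)
    (p : seq (A * B)) : Prop :=
  forall u v, u \in p -> v \in p -> ltA u.1 v.1 <-> ltB u.2 v.2.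

Lemma partial_iso_swap (A B : eqType) (ltA : A -> A -> Prop) (ltB : B -> B -> Prop)
    (p : seq (A * B)) :
  partial_iso ltA ltB p -> partial_iso ltB ltA [seq (u.2, u.1) | u <- p].
Proof.
by move=> iso u v /mapP[u' pu ->] /mapP[v' pv ->] /=; split; move/(iso _ _ pu pv).
Qed.

(** A point already matched keeps its partner; a new one is sent into the cut formed by the partners
    of the points below and above it. *)
Lemma partial_iso_extend (A B : eqType) (ltA : A -> A -> Prop)
    (ltB : B -> B -> Prop) (p : seq (A * B)) (a : A) :
  inhabited B -> dense_order ltA -> dense_order ltB -> partial_iso ltA ltB p ->
  exists b, partial_iso ltA ltB ((a, b) :: p).
Proof.
move=> iB dA dB iso; have [irrA trA totA _ _] := dA.
have [irrB trB totB _ _] := dB.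
have [[b pab]|nab] := pselect (exists b, (a, b) \in p).
  exists b => u v; rewrite !inE => /predU1P[->|pu] /predU1P[->|pv]; exact: iso.
pose lo := [seq u.2 | u <- p & `[< ltA u.1 a >]].
pose hi := [seq u.2 | u <- p & `[< ltA a u.1 >]].
have cut x y : x \in lo -> y \in hi -> ltB x y.
  move=> /mapP[u]; rewrite mem_filter => /andP[/asboolP ua pu] ->.
  move=> /mapP[v]; rewrite mem_filter => /andP[/asboolP av pv] ->.
  by apply/(iso _ _ pu pv); exact: trA ua av.
have [b [lob bhi]] := dense_order_cut iB dB cut.
exists b => u v; have irr_ab : ltA a a <-> ltB b b by split=> [/irrA|/irrB].
have side w : w \in p ->
    ltA w.1 a /\ ltB w.2 b \/ ltA a w.1 /\ ltB b w.2.
  move=> pw; case: (totA w.1 a) => [wa|wa|aw].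
  - left; split=> //; apply: lob; apply: map_f; rewrite mem_filter pw andbT.
    exact/asboolP.
  - by case: nab; exists w.2; rewrite -wa -surjective_pairing.
  - right; split=> //; apply: bhi; apply: map_f; rewrite mem_filter pw andbT.
    exact/asboolP.
have asymA x y : ltA x y -> ltA y x -> False by move=> xy /(trA _ _ _ xy)/irrA.
have asymB x y : ltB x y -> ltB y x -> False by move=> xy /(trB _ _ _ xy)/irrB.
rewrite !inE => /predU1P[->|pu] /predU1P[->|pv] //=; last exact: iso.
- by case: (side _ pv) => -[ltA1 ltB1]; split=> // lt;
    [case: (asymA _ _ ltA1 lt)|case: (asymB _ _ ltB1 lt)].
- by case: (side _ pu) => -[ltA1 ltB1]; split=> // lt;
    [case: (asymA _ _ ltA1 lt)|case: (asymB _ _ ltB1 lt)].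
Qed.

Lemma partial_iso_extend_right (A B : eqType) (ltA : A -> A -> Prop)
    (ltB : B -> B -> Prop) (p : seq (A * B)) (b : B) :
  inhabited A -> dense_order ltA -> dense_order ltB -> partial_iso ltA ltB p ->
  exists a, partial_iso ltA ltB ((a, b) :: p).
Proof.
move=> iA dA dB iso.
have [a H] := partial_iso_extend b iA dB dA (partial_iso_swap iso).
exists a; have := partial_iso_swap H; rewrite /= -map_comp.
by rewrite (@eq_map _ _ _ id) ?map_id // => -[].
Qed.

(** Back and forth: stage [k] matches first [u k] and then [w k], so all points of both orders get
    matched. *)
Lemma cantor_isomorphism (A B : eqType) (ltA : A -> A -> Prop)
    (ltB : B -> B -> Prop) (u : nat -> A) (w : nat -> B) :
  dense_order ltA -> dense_order ltB ->
  (forall a, exists n, u n = a) -> (forall b, exists n, w n = b) ->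
  order_iso ltA ltB.
Proof.
move=> dA dB su sw; have iA := inhabits (u 0); have iB := inhabits (w 0).
have [irrB trB totB _ _] := dB; have [irrA _ totA _ _] := dA.
pose iso := partial_iso ltA ltB.
have /choice[f Hf] : forall pa : seq (A * B) * A,
    exists b, iso pa.1 -> iso ((pa.2, b) :: pa.1).
  move=> [p a]; have [ip|np] := pselect (iso p).
    by have [b Hb] := partial_iso_extend a iB dA dB ip; exists b.
  by exists (w 0).
have /choice[g Hg] : forall pb : seq (A * B) * B,
    exists a, iso pb.1 -> iso ((a, pb.2) :: pb.1).
  move=> [p b]; have [ip|np] := pselect (iso p).
    by have [a Ha] := partial_iso_extend_right b iA dA dB ip; exists a.
  by exists (u 0).
pose left_step p n := (u n, f (p, u n)) :: p.
pose right_step p n := (g (p, w n), w n) :: p.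
pose P := fix P n := if n is k.+1 then right_step (left_step (P k) k) k else [::].
have isoP n : iso (P n).
  elim: n => [//|n IH]; apply: (Hg (left_step (P n) n, w n)).
  exact: (Hf (P n, u n)).
have Pmono m n : m <= n -> {subset P m <= P n}.
  move=> le; rewrite -(subnKC le); elim: (n - m) => [|d IH] x Px.
    by rewrite addn0.
  by rewrite addnS !inE (IH _ Px) !orbT.
have iso_all x y : (exists m, x \in P m) -> (exists n, y \in P n) ->
    ltA x.1 y.1 <-> ltB x.2 y.2.
  move=> [m Px] [n Py]; apply: (isoP (maxn m n)).
    exact: Pmono (leq_maxl _ _) _ Px.
  exact: Pmono (leq_maxr _ _) _ Py.
have [nu nuK] := choice su.
pose h a := f (P (nu a), u (nu a)).
have Ph a : exists n, (a, h a) \in P n.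
  by exists (nu a).+1; rewrite !inE /h [u _]nuK eqxx orbT.
apply: (@order_iso_surj _ _ _ _ h) => //.
  by move=> x y; move/(iso_all (x, h x) (y, h y) (Ph x) (Ph y)).
move=> b; have [n wn] := sw b.
have [a Pab] : exists a, (a, b) \in P n.+1.
  by exists (g (left_step (P n) n, w n)); rewrite /= inE wn eqxx.
exists a; have Pb : exists n, (a, b) \in P n by exists n.+1.
have [lt|//|lt] := totB (h a) b.
  by have /irrA := (iso_all (a, h a) (a, b) (Ph a) Pb).2 lt.
by have /irrA := (iso_all (a, b) (a, h a) Pb (Ph a)).2 lt.
Qed.

Lemma rat_dense_order : dense_order eta_lt.
Proof.
rewrite /eta_lt; split=> [x|x y z|x y|x y|x].
- by rewrite Order.POrderTheory.ltxx.
- exact: Order.POrderTheory.lt_trans.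
- by case: (Order.TotalTheory.ltgtP x y); [constructor 1|constructor 3|constructor 2].
- move=> lt; exists ((x + y) / 2)%R.
  by have [xz zy] := Num.Theory.midf_lt lt.
- split; [exists (x + 1)%R|exists (x - 1)%R].
    by rewrite Num.Theory.ltrDl Num.Theory.ltr01.
  by rewrite Num.Theory.ltrBlDr Num.Theory.ltrDl Num.Theory.ltr01.
Qed.

Lemma rat_enumeration : exists w : nat -> rat, forall q, exists n, w n = q.
Proof.
exists (fun n => odflt 0%R (unpickle n)) => q.
by exists (pickle q); rewrite pickleK.
Qed.

(** * Partial computable functions modulo a cohesive set *)

Lemma code_function c : exists phi : nat -> option nat,
  forall n y, phi n = Some y <-> computes c [:: n] y.
Proof.
have /choice[phi Hphi] : forall n, exists o : option nat,
    forall y, o = Some y <-> computes c [:: n] y.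
  move=> n; have [[y Hy]|nc] := pselect (exists y, computes c [:: n] y).
    by exists (Some y) => z; split=> [[<-]//|/(computes_inj Hy)->].
  by exists None => z; split=> // Hz; case: nc; exists z.
by exists phi.
Qed.

Definition opair (phi psi : nat -> option nat) (n : nat) : option nat :=
  if phi n is Some x then omap (npair x) (psi n) else None.

Lemma opairP phi psi n z : opair phi psi n = Some z <->
  exists x y, [/\ phi n = Some x, psi n = Some y & z = npair x y].
Proof.
rewrite /opair; case: (phi n) => [x|]; last by split=> // -[x [y []]].
case: (psi n) => [y|]; last by split=> // -[? [? []]].
split=> [[<-]|[? [? [[<-] [<-] ->]]]] //.
by exists x, y.
Qed.

Lemma partial_computable_opair phi psi : partial_computable phi ->
  partial_computable psi -> partial_computable (opair phi psi).
Proof.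
move=> [c Hc] [d Hd]; have [p Hp] : compv (fun v => npair (nth 0 v 0) (nth 0 v 1)).
  have cs := compv_add (compv_nth 0) (compv_nth 1).
  exact: compv_add (compv_mul cs cs) (compv_nth 0).
exists (RComp p [:: c; d]) => n z; rewrite opairP computes_comp; split.
  move=> [x [y [/Hc Hx /Hd Hy ->]]].
  by exists [:: x; y]; [|exact: (Hp [:: x; y])].
move=> [[|x [|y [|? ?]]] //=]; [by case=> _ []| |by case=> _ [_ []]].
move=> [Hx [Hy _]] /(computes_inj (Hp [:: x; y])) <-.
by exists x, y; split=> //; [apply/Hc|apply/Hd].
Qed.

Lemma partial_computable_omap h phi : comp1 h -> partial_computable phi ->
  partial_computable (fun n => omap h (phi n)).
Proof.
move=> [d Hd] [c Hc]; exists (RComp d [:: c]) => n z; rewrite computes_comp; split.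
  case E: (phi n) => [x|] //= [<-]; exists [:: x] => //.
  by split=> //; apply/Hc.
move=> [[|x [|? ?]] //=]; last by case=> _ [].
by move=> [/Hc -> _] /(computes_inj (Hd x)) <-.
Qed.

Lemma partial_computable_comp1 h : comp1 h -> partial_computable (fun n => Some (h n)).
Proof.
move=> [c Hc]; exists c => n y; split=> [[<-]//|].
by move/(computes_inj (Hc n)) ->.
Qed.

(** Minimization looks for a zero, so it is applied to the negation of [P]; it converges exactly
    where a witness exists. *)
Lemma partial_computable_search (P : nat -> pred nat) phi :
  comp1 (fun z => P (pi1 z) (pi2 z) : nat) -> partial_computable phi ->
  exists2 theta, partial_computable theta &
    forall n, (theta n != None <-> exists x, phi n = Some x /\ exists k, P x k) /\
      forall k, theta n = Some k -> exists2 x, phi n = Some x & P x k.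
Proof.
move=> /comp1_neg[d Hd] [c Hc].
have [p Hp] : compv (fun v => npair (nth 0 v 1) (nth 0 v 0)).
  have cs := compv_add (compv_nth 1) (compv_nth 0).
  exact: compv_add (compv_mul cs cs) (compv_nth 1).
have Ht k x : computes (RComp d [:: p]) [:: k; x] (~~ P x k).
  apply/computes_comp; exists [:: npair x k]; first by split=> //; exact: (Hp [:: k; x]).
  by have := Hd (npair x k); rewrite !piK.
have [theta Htheta] := code_function (RComp (RMu (RComp d [:: p])) [:: c]).
have thetaP n k : theta n = Some k ->
    exists2 x, phi n = Some x & P x k.
  move=> /Htheta/computes_comp[[|x [|? ?]] //=]; last by case=> _ [].
  move=> [/Hc -> _] [/(computes_inj (Ht k x)) E _]; exists x => //.
  by move: E; case: (P x k).
exists theta; first by exists (RComp (RMu (RComp d [:: p])) [:: c]).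
move=> n; split; last exact: thetaP.
split.
  case E: (theta n) => [k|] // _; have [x fx Pxk] := thetaP _ _ E.
  by exists x; split=> //; exists k.
move=> [x [fx exk]]; have [k Pk min_k] := ex_minnP exk.
suff -> : theta n = Some k by [].
apply/Htheta/computes_comp; exists [:: x]; first by split=> //; apply/Hc.
split; first by have := Ht k x; rewrite Pk.
move=> z lt_z; exists 0; have := Ht z x.
by case Pz: (P x z) => //; move/min_k: Pz; rewrite leqNgt lt_z.
Qed.

Lemma ce_set_search (P : nat -> pred nat) phi :
  comp1 (fun z => P (pi1 z) (pi2 z) : nat) -> partial_computable phi ->
  ce_set [set n | exists x, phi n = Some x /\ exists k, P x k].
Proof.
move=> cP cphi; have [theta [c Hc] Htheta] := partial_computable_search cP cphi.
exists c; apply/seteqP; split=> n /=.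
  by move/(Htheta n).1; case E: (theta n) => [y|] // _; exists y; apply/Hc.
by move=> [y /Hc E]; apply/(Htheta n).1; rewrite E.
Qed.

Lemma ce_set_decidable (P : pred nat) phi :
  comp1 (fun x => P x : nat) -> partial_computable phi ->
  ce_set [set n | exists2 x, phi n = Some x & P x].
Proof.
move=> cP cphi; have := @ce_set_search (fun x _ => P x) phi.
move=> /(_ (comp1_subst cP (comp1_pi1 comp1_id)) cphi).
congr ce_set; apply/seteqP; split=> n /= [x]; first by move=> [? [_ ?]]; exists x.
by move=> ? ?; exists x; split=> //; exists 0.
Qed.

(** * Properties holding almost everywhere on a cohesive set *)

Definition ae (C : set nat) (P : nat -> Prop) : Prop :=
  exists b, forall n, b <= n -> C n -> P n.

Lemma almost_subsetE C X : almost_subset C X <-> ae C X.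
Proof.
split=> [/finite_seqP[s Es]|[b Hb]].
  exists (\max_(i <- s) i).+1 => n lt_n Cn; apply: contrapT => nX.
  have : (C `\` X) n by [].
  rewrite Es /= => sn; move: lt_n; rewrite ltnNge => /negP; apply.
  exact: (@leq_bigmax_seq _ _ xpredT id).
apply: sub_finite_set (finite_II b) => n [Cn nX] /=.
by rewrite ltnNge; apply/negP => /Hb/(_ Cn).
Qed.

Lemma ae_and C P Q : ae C P -> ae C Q -> ae C (fun n => P n /\ Q n).
Proof.
move=> [b Pb] [b' Qb]; exists (maxn b b') => n; rewrite geq_max => /andP[bn b'n] Cn.
by split; [exact: Pb|exact: Qb].
Qed.

Lemma ae_imp C (P Q : nat -> Prop) : (forall n, P n -> Q n) -> ae C P -> ae C Q.
Proof. by move=> PQ [b H]; exists b => n bn /(H n bn)/PQ. Qed.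

Lemma cohesive_unbounded C b : cohesive C -> exists2 n, b <= n & C n.
Proof.
move=> [infC _]; apply: contrapT => noC; apply: infC.
apply: sub_finite_set (finite_II b) => n Cn /=; rewrite ltnNge; apply/negP => bn.
by apply: noC; exists n.
Qed.

Lemma ae_ex C P : cohesive C -> ae C P -> exists n, C n /\ P n.
Proof.
move=> /cohesive_unbounded cohC [b H]; have [n bn Cn] := cohC b.
by exists n; split=> //; exact: H.
Qed.

Lemma cohesive_ae C W : cohesive C -> ce_set W -> ae C W \/ ae C (fun n => ~ W n).
Proof. by move=> [_ H] /H[] /almost_subsetE; [left|right]. Qed.

Lemma bounded_below_stage (f : nat -> option nat) b :
  exists B, forall n y, n < b -> f n = Some y -> y < B.
Proof.
elim: b => [|b [B HB]]; first by exists 0.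
exists (maxn B (odflt 0 (f b)).+1) => n y; rewrite ltnS leq_eqVlt leq_max.
by case/predU1P => [-> ->|lt /(HB _ _ lt)->//]; rewrite /= ltnSn orbT.
Qed.

(** The search for a point between [phi n] and [psi n] succeeds for almost all [n] in [C] or fails
    for almost all. If it fails, the two points are neighbours, so the block of [phi n] is not
    refined after both have appeared. The count of a strategy working on that block is then final
    and computable from [n], and its parity splits [C]. *)
Lemma ae_between C phi psi : cohesive C -> Delta2 C ->
  partial_computable phi -> partial_computable psi ->
  (forall j, ae C (fun n => exists2 x, phi n = Some x & j <= blk x)) ->
  ae C (fun n => exists x y, [/\ phi n = Some x, psi n = Some y & ltL x y]) ->
  exists theta, [/\ partial_computable theta,
    forall n z, theta n = Some z -> inL z
    & ae C (fun n => exists x z y, [/\ phi n = Some x, theta n = Some z,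
        psi n = Some y, ltL x z & ltL z y])].
Proof.
move=> cohC D2C cphi cpsi phi_unb lt_ae.
pose P z k := ltL (pi1 z) k && ltL k (pi2 z).
have cP : comp1 (fun z => P (pi1 z) (pi2 z) : nat).
  by apply: comp1_and; apply: comp1_ltL; auto with comp1.
have cpp := partial_computable_opair cphi cpsi.
have [theta ctheta Htheta] := partial_computable_search cP cpp.
have [Hb|Hn] := cohesive_ae cohC (ce_set_search cP cpp).
  exists theta; split=> // [n z /(Htheta n).2[w _ /andP[/ltL_dom[]]]//|].
  apply: ae_imp Hb => n /(Htheta n).1.
  case E: (theta n) => [z|] // _.
  have [_ /opairP[x [y [fx gy ->]]]] := (Htheta n).2 _ E.
  by rewrite /P !piK => /andP[xz zy]; exists x, z, y.
exfalso; have [b Hadj] := ae_and lt_ae Hn.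
pose f n := omap blk (phi n).
have cf : partial_computable f.
  apply: partial_computable_omap cphi.
  by rewrite /blk; auto with comp1.
have [c Hc] := cf; have [p [q Hpq]] := Delta2_approx D2C.
have fdef n : b <= n -> C n -> exists y, f n = Some y.
  by move=> bn Cn; have [[x [y [fx _ _]]] _] := Hadj _ bn Cn; exists (blk x); rewrite /f fx.
have funb j : exists n y, [/\ b <= n, C n, f n = Some y & j <= y].
  have [b' Hb'] := phi_unb j; have [n] := cohesive_unbounded (maxn b b') cohC.
  rewrite geq_max => /andP[bn b'n] Cn; have [x fx jx] := Hb' _ b'n Cn.
  by exists n, (blk x); split=> //; rewrite /f fx.
have [J [Jcv Jinf Jf]] := guess_converges Hpq Hc fdef funb.
(* This is the strategy that guesses blocks met by [phi] on [C] from [b] on. *)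
set e := npair b _ in Jcv.
(* For a pair of points, this stage is the first at which both are present. *)
pose Q z := odd (act (guess e) (maxn (stg (pi1 z)) (stg (pi2 z))) (blk (pi1 z))).
have cQ : comp1 (fun z => Q z : nat).
  apply: comp1_odd; apply: comp1_act.
  - by apply: comp1_guess; auto 10 with comp1.
  - exact: comp1_const.
  - by rewrite /maxn /stg; auto 20 with comp1.
  - by rewrite /blk; auto with comp1.
have split_C v b' : exists n, [/\ b' <= n, C n &
    (exists2 z, opair phi psi n = Some z & Q z) <-> v = true].
  have [B HB] := bounded_below_stage f b'.
  (* The block must exceed [e] for this strategy to count on it, and a value of [f] not below [B]
     occurs only at some [n >= b']. *)
  have [j [le_j Jj par]] := act_parity_unbounded Jcv Jinf v (maxn e.+1 B).
  move: le_j; rewrite geq_max => /andP[lt_e leB]; have [n [bn Cn fn]] := Jf _ Jj.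
  have [[x [y [fx gy xy]]] nobetw] := Hadj _ bn Cn.
  have Ej : blk x = j by move: fn; rewrite /f fx => -[].
  exists n; split=> //.
    by rewrite leqNgt; apply/negP => /HB/(_ fn); rewrite ltnNge leB.
  have Epp : opair phi psi n = Some (npair x y) by apply/opairP; exists x, y.
  have EQ : Q (npair x y) = v.
    rewrite /Q !piK -par -Ej refine_stable // ?Ej // => t; rewrite -Ej.
    rewrite leqNgt; apply/negP => /(refine_between xy)[z lt_z]; apply: nobetw.
    by exists (npair x y); split=> //; exists z; rewrite /P !piK.
  rewrite Epp; split=> [[z [<-]]|vt]; first by rewrite EQ.
  by exists (npair x y); rewrite ?EQ.
(* Whichever parity prevails on [C], [split_C] gives a late member of [C] with the other one. *)
have [[b' Hb']|[b' Hb']] := cohesive_ae cohC (ce_set_decidable cQ cpp).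
  by have [n [/Hb' H /H Hn' E]] := split_C false b'; have := E.1 Hn'.
by have [n [/Hb' H /H Hn' E]] := split_C true b'; apply: Hn'; apply/E.
Qed.

(** * Cohesive powers *)

Definition flt (L : computable_linear_order) (C : set nat)
    (phi psi : nat -> option nat) : Prop :=
  ae C (fun n => exists x y, [/\ phi n = Some x, psi n = Some y & clo_lt L x y]).

Definition feq (C : set nat) (phi psi : nat -> option nat) : Prop :=
  ae C (fun n => exists x, phi n = Some x /\ psi n = Some x).

Lemma feq_sym C phi psi : feq C phi psi -> feq C psi phi.
Proof. by apply: ae_imp => n [x [fx gx]]; exists x. Qed.

Lemma feq_trans C phi psi chi : feq C phi psi -> feq C psi chi -> feq C phi chi.
Proof.
move=> E E'; apply: ae_imp (ae_and E E') => n [[x [fx gx]] [y [gy hy]]].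
by exists x; rewrite hy; move: gy; rewrite gx.
Qed.

Lemma feq_flt L C phi phi' psi psi' :
  feq C phi phi' -> feq C psi psi' -> flt L C phi psi -> flt L C phi' psi'.
Proof.
move=> E E' lt; apply: ae_imp (ae_and lt (ae_and E E')) => n.
move=> [[x [y [fx gy xy]]] [[x' [fx' ->]] [y' [gy' ->]]]].
by exists x, y; move: fx' gy'; rewrite fx gy => -[<-] [<-].
Qed.

Lemma flt_trans L C phi psi chi : flt L C phi psi -> flt L C psi chi -> flt L C phi chi.
Proof.
move=> lt lt'; apply: ae_imp (ae_and lt lt') => n.
move=> [[x [y [fx gy xy]]] [y' [z [gy' hz yz]]]]; exists x, z; split=> //.
by move: gy'; rewrite gy => -[E]; apply: clo_lt_trans xy _; rewrite E.
Qed.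

Lemma flt_irr L C phi : cohesive C -> ~ flt L C phi phi.
Proof.
move=> cohC /(ae_ex cohC)[n [_ [x [y [-> [->]]]]]].
exact/negP/clo_lt_irr.
Qed.

Lemma cpow_dom_feq L C phi : cpow_dom L C phi -> feq C phi phi.
Proof.
move=> [_ _ /almost_subsetE]; apply: ae_imp => n /=.
by case: (phi n) => // x _; exists x.
Qed.

(** One chosen representative per class reduces the order on classes to [flt] on functions. *)
Lemma cpow_representatives L C : exists rep : cohesive_power L C -> nat -> option nat,
  [/\ forall X, cpow_dom L C (rep X),
      forall X Y, cpow_lt L C X Y <-> flt L C (rep X) (rep Y),
      forall X Y, feq C (rep X) (rep Y) -> X = Y
    & forall phi, cpow_dom L C phi -> exists X, feq C (rep X) phi].
Proof.
have /choice[rep Hrep] : forall X : cohesive_power L C, exists phi,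
    cpow_dom L C phi /\ cpow_class L C phi = set_val X.
  by move=> X; have [phi Dphi E] := set_valP X; exists phi.
have repD X : cpow_dom L C (rep X) by have [] := Hrep X.
have feqE phi psi : cpow_eq C phi psi <-> feq C phi psi.
  exact: almost_subsetE.
have rep_in X psi : set_val X psi <-> cpow_dom L C psi /\ feq C (rep X) psi.
  by have [_ <-] := Hrep X; rewrite /cpow_class /= feqE.
exists rep; split=> // [X Y|X Y E|phi Dphi].
- split=> [[psi [phi [/rep_in[_ E] /rep_in[_ E'] /almost_subsetE lt]]]|lt].
    exact: feq_flt (feq_sym E) (feq_sym E') lt.
  exists (rep X), (rep Y); split; last exact/almost_subsetE.
    by apply/rep_in; split=> //; exact: cpow_dom_feq.
  by apply/rep_in; split=> //; exact: cpow_dom_feq.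
- apply: val_inj; rewrite -!set_valE; apply/seteqP.
  split=> psi /rep_in[Dpsi E']; apply/rep_in; split=> //.
    exact: feq_trans (feq_sym E) E'.
  exact: feq_trans E E'.
- have in_im : cpow_class L C phi \in cpow_class L C @` cpow_dom L C.
    by apply/mem_set; exists phi.
  pose X : cohesive_power L C := SigSub in_im; exists X.
  have /rep_in[] // : set_val X phi.
  rewrite set_valE /=; split=> //; apply/feqE; exact: cpow_dom_feq Dphi.
Qed.

(** The order on labels is decidable, so the [n] with [phi n] below [psi n] form a c.e. set, which
    almost contains or almost misses [C]. If both strict comparisons fail almost everywhere, the
    values agree. *)
Lemma flt_total C phi psi : cohesive C ->
  cpow_dom denseL C phi -> cpow_dom denseL C psi ->
  [\/ flt denseL C phi psi, feq C phi psi | flt denseL C psi phi].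
Proof.
move=> cohC [cphi phiL /almost_subsetE phi_def] [cpsi psiL /almost_subsetE psi_def].
have lt_or f g : partial_computable f -> partial_computable g ->
    flt denseL C f g \/
    ae C (fun n => forall x y, f n = Some x -> g n = Some y -> ~~ ltL x y).
  move=> cf cg; have cP : comp1 (fun z => ltL (pi1 z) (pi2 z) : nat).
    by apply: comp1_ltL; auto with comp1.
  have := cohesive_ae cohC (ce_set_decidable cP (partial_computable_opair cf cg)).
  case=> H; [left|right]; apply: ae_imp H => n /=.
    by move=> [z /opairP[x [y [fx gy ->]]]]; rewrite !piK => lt; exists x, y.
  move=> nH x y fx gy; apply/negP => lt; apply: nH; exists (npair x y).
    by apply/opairP; exists x, y.
  by rewrite !piK.
have [lt|nlt] := lt_or _ _ cphi cpsi; first by constructor 1.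
have [lt|nlt'] := lt_or _ _ cpsi cphi; first by constructor 3.
constructor 2; apply: ae_imp (ae_and (ae_and nlt nlt') (ae_and phi_def psi_def)) => n /=.
case fx: (phi n) => [x|] [[H H']] [//]; case gy: (psi n) => [y|] // _ _.
have := H _ _ erefl gy; have := H' _ _ gy erefl.
have [->|->|->] := ltL_total (phiL _ _ fx) (psiL _ _ gy) => //.
by exists y.
Qed.

(** * Standard and nonstandard elements *)

Definition const_fun (x : nat) : nat -> option nat := fun=> Some x.

Definition standard (C : set nat) (phi : nat -> option nat) : Prop :=
  exists2 x, inL x & feq C phi (const_fun x).

Lemma cpow_dom_total C h : comp1 h -> (forall n, inL (h n)) ->
  cpow_dom denseL C (fun n => Some (h n)).
Proof.
move=> ch hL; split; first exact: partial_computable_comp1.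
  by move=> n x [<-]; exact: hL.
by apply/almost_subsetE; exists 0.
Qed.

Lemma cpow_dom_const C x : inL x -> cpow_dom denseL C (const_fun x).
Proof. by move=> Lx; apply: cpow_dom_total => //; exact: comp1_const. Qed.

Lemma cpow_dom_omap C h phi : comp1 h -> (forall x, inL x -> inL (h x)) ->
  cpow_dom denseL C phi -> cpow_dom denseL C (fun n => omap h (phi n)).
Proof.
move=> ch hL [cphi phiL phi_def]; split.
- exact: partial_computable_omap.
- by move=> n y; case E: (phi n) => [x|] //= [<-]; apply: hL; exact: phiL E.
- move/almost_subsetE: phi_def => phi_def; apply/almost_subsetE.
  by apply: ae_imp phi_def => n /=; case: (phi n).
Qed.

Lemma standard_feq C phi psi : feq C phi psi -> standard C psi -> standard C phi.
Proof. by move=> E [x Lx E']; exists x => //; exact: feq_trans E E'. Qed.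

Lemma ltL_finite x : exists s : seq nat, forall y, ltL y x -> y \in s.
Proof.
have [f [g fK gK] mono] := denseL_omega.
have [Lx|nLx] := boolP (inL x); last first.
  by exists [::] => y /ltL_dom[_ Lx]; rewrite Lx in nLx.
pose u : {n | inL n} := exist (fun n => inL n) x Lx.
exists [seq val (g k) | k <- iota 0 (f u)] => y lt; have [Ly _] := ltL_dom lt.
apply/mapP; exists (f (exist (fun n => inL n) y Ly)); last by rewrite fK.
by rewrite mem_iota /=; apply/mono.
Qed.

(** Below a constant only finitely many values are possible. For each value, the c.e. set where it
    is taken almost contains [C] or almost misses it, and not all of them can miss it. *)
Lemma flt_standard C phi x : cohesive C -> cpow_dom denseL C phi ->
  flt denseL C phi (const_fun x) -> standard C phi.
Proof.
move=> cohC [cphi phiL _] lt; have [s Hs] := ltL_finite x.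
have {Hs}lt_s : ae C (fun n => exists2 y, y \in s & phi n = Some y).
  by apply: ae_imp lt => n [y [z [fy [<-] yx]]]; exists y => //; exact: Hs.
elim: s lt_s => [|y s IH] lt_s.
  by have [n [_ []]] := ae_ex cohC lt_s.
have cP : comp1 (fun z => z == y : nat) by auto with comp1.
have [E|nE] := cohesive_ae cohC (ce_set_decidable cP cphi).
  have [n [_ [z fz /eqP zy]]] := ae_ex cohC E.
  exists y; first by rewrite -zy; exact: phiL fz.
  by apply: ae_imp E => k [w fw /eqP <-]; exists w.
apply: IH; apply: ae_imp (ae_and lt_s nE) => n [[z]]; rewrite inE => /predU1P[->|zs] fz.
  by case; exists y.
by exists z.
Qed.

Lemma nonstandard_above C phi x : cohesive C -> cpow_dom denseL C phi ->
  ~ standard C phi -> inL x -> flt denseL C (const_fun x) phi.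
Proof.
move=> cohC Dphi nst Lx.
have [//|E|lt] := flt_total cohC (cpow_dom_const C Lx) Dphi.
  by case: nst; exists x => //; exact: feq_sym.
by case: nst; exact: flt_standard lt.
Qed.

Lemma nonstandard_blk C phi j : cohesive C -> cpow_dom denseL C phi ->
  ~ standard C phi -> ae C (fun n => exists2 x, phi n = Some x & j <= blk x).
Proof.
move=> cohC Dphi nst.
apply: ae_imp (nonstandard_above cohC Dphi nst (inL_first j)) => n.
move=> [_ [x [[<-] fx /and3P[_ _]]]]; rewrite labelK => lt; exists x => //.
by case/orP: lt => [/ltnW//|/andP[/eqP-> _]].
Qed.

Lemma nonstandard_of_blk C phi : cohesive C ->
  (forall j, ae C (fun n => exists2 x, phi n = Some x & j <= blk x)) ->
  ~ standard C phi.
Proof.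
move=> cohC H [x _ E]; have [n [_ [[y fy lt] [z [fz [zx]]]]]] :=
  ae_ex cohC (ae_and (H (blk x).+1) E).
by move: fz lt; rewrite fy -zx => -[->]; rewrite ltnn.
Qed.

Lemma nonstandard_exists C : cohesive C ->
  exists2 phi, cpow_dom denseL C phi & ~ standard C phi.
Proof.
move=> cohC; exists (fun n => Some (label n 0 0)).
  apply: cpow_dom_total; last exact: inL_first.
  by rewrite /label; auto 20 with comp1.
apply: nonstandard_of_blk => // j; exists j => n le_j _.
by exists (label n 0 0); rewrite ?labelK.
Qed.

Lemma nonstandard_greater C phi : cohesive C -> cpow_dom denseL C phi ->
  ~ standard C phi -> exists psi, [/\ cpow_dom denseL C psi, ~ standard C psi
    & flt denseL C phi psi].
Proof.
move=> cohC Dphi nst; pose h x := label (blk x).+1 0 0.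
have ch : comp1 h by rewrite /h /label /blk; auto 20 with comp1.
exists (fun n => omap h (phi n)); split.
- by apply: cpow_dom_omap => // x _; exact: inL_first.
- apply: nonstandard_of_blk => // j.
  apply: ae_imp (nonstandard_blk j cohC Dphi nst) => n [x -> le_j].
  by exists (h x) => //; rewrite labelK leqW.
- have [_ phiL /almost_subsetE phi_def] := Dphi; apply: ae_imp phi_def => n /=.
  case fx: (phi n) => [x|] // _; exists x, (h x); split=> //.
  by apply: ltL_blk; [exact: phiL fx|exact: inL_first|rewrite labelK].
Qed.

(** The first point of the previous block works: blocks still tend to infinity along [C], and almost
    everywhere on [C] a previous block exists. *)
Lemma nonstandard_smaller C phi : cohesive C -> cpow_dom denseL C phi ->
  ~ standard C phi -> exists psi, [/\ cpow_dom denseL C psi, ~ standard C psi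
    & flt denseL C psi phi].
Proof.
move=> cohC Dphi nst; pose h x := label (blk x).-1 0 0.
have ch : comp1 h by rewrite /h /label /blk; auto 20 with comp1.
exists (fun n => omap h (phi n)); split.
- by apply: cpow_dom_omap => // x _; exact: inL_first.
- apply: nonstandard_of_blk => // j.
  apply: ae_imp (nonstandard_blk j.+1 cohC Dphi nst) => n [x -> lt_j].
  by exists (h x) => //; rewrite labelK -ltnS prednK // (leq_trans _ lt_j).
- have [_ phiL _] := Dphi; apply: ae_imp (nonstandard_blk 1 cohC Dphi nst) => n.
  move=> [x fx lt0]; exists (h x), x; rewrite fx; split=> //.
  by apply: ltL_blk; [exact: inL_first|exact: phiL fx|rewrite labelK prednK].
Qed.

Lemma nonstandard_between C phi psi : cohesive C -> Delta2 C ->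
  cpow_dom denseL C phi -> cpow_dom denseL C psi -> ~ standard C phi ->
  flt denseL C phi psi ->
  exists theta, [/\ cpow_dom denseL C theta, ~ standard C theta,
    flt denseL C phi theta & flt denseL C theta psi].
Proof.
move=> cohC D2C Dphi Dpsi nst lt; have [[cphi phiL _] [cpsi psiL _]] := (Dphi, Dpsi).
have phi_unb j := nonstandard_blk j cohC Dphi nst.
have [theta [ctheta thetaL Htheta]] := ae_between cohC D2C cphi cpsi phi_unb lt.
have Dtheta : cpow_dom denseL C theta.
  split=> //; apply/almost_subsetE; apply: ae_imp Htheta => n /=.
  by move=> [x [z [y [_ -> _ _ _]]]].
have lt1 : flt denseL C phi theta.
  by apply: ae_imp Htheta => n [x [z [y [fx hz _ xz _]]]]; exists x, z.
exists theta; split=> //; last first.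
  by apply: ae_imp Htheta => n [x [z [y [_ hz gy _ zy]]]]; exists z, y.
(* A standard [theta] would make [phi], which lies below it, standard too. *)
move=> [x Lx E]; apply: nst; apply: (flt_standard (x := x)) => //.
exact: feq_flt (cpow_dom_feq Dphi) E lt1.
Qed.

(** Countability of the power: functions are numbered by their codes. The universal machine sees
    only the number, so functions with equal numbers agree where both are defined. *)
Lemma partial_computable_enumeration C L : exists num : nat -> (nat -> option nat) -> Prop,
  (forall phi, cpow_dom L C phi -> exists n, num n phi) /\
  (forall n phi psi, cpow_dom L C phi -> cpow_dom L C psi ->
    num n phi -> num n psi -> feq C phi psi).
Proof.
exists (fun k phi => exists2 c, enc c = k &
  forall n y, phi n = Some y <-> computes c [:: n] y); split.
  by move=> phi [[c Hc] _ _]; exists (enc c), c.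
move=> k phi psi /cpow_dom_feq E /cpow_dom_feq E' [c ck Hc] [d dk Hd].
apply: ae_imp (ae_and E E') => n [[x [fx _]] [y [gy _]]].
have [t Ht] := ev_converges ((Hd n y).1 gy); have := Ht t (leqnn t).
rewrite dk -ck => /(ev_value ((Hc n x).1 fx)) yx.
by exists x; rewrite gy yx.
Qed.

(** * The order type of the cohesive powers *)

Theorem corollary4p2 :
  exists L : computable_linear_order,
    computable_copy_of_omega L /\
    forall C : set nat, Delta2 C -> cohesive C ->
      order_iso (cpow_lt L C) (sum_lt omega_lt eta_lt).
Proof.
exists denseL; split; first exact: denseL_omega.
move=> C D2C cohC; have [rep [repD ltE rep_inj rep_surj]] := cpow_representatives denseL C.
have tot X Y : [\/ cpow_lt denseL C X Y, X = Y | cpow_lt denseL C Y X].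
  have [lt|E|lt] := flt_total cohC (repD X) (repD Y).
  - by constructor 1; apply/ltE.
  - by constructor 2; exact: rep_inj.
  - by constructor 3; apply/ltE.
have irr X : ~ cpow_lt denseL C X X by move/ltE; exact: flt_irr.
have tr X Y Z : cpow_lt denseL C X Y -> cpow_lt denseL C Y Z -> cpow_lt denseL C X Z.
  by move=> /ltE XY /ltE YZ; apply/ltE; exact: flt_trans XY YZ.
pose N := {X | ~ standard C (rep X)}.
pose ltN (x y : {classic N}) := cpow_lt denseL C (proj1_sig x) (proj1_sig y).
have inN phi : cpow_dom denseL C phi -> ~ standard C phi ->
    exists x : N, feq C (rep (proj1_sig x)) phi.
  move=> Dphi nst; have [X E] := rep_surj _ Dphi.
  have nX : ~ standard C (rep X) by move/(standard_feq (feq_sym E)).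
  by exists (exist _ X nX).
have dN : dense_order ltN.
  split=> [x|x y z|[X nX] [Y nY]|[X nX] [Y nY]|[X nX]].
  - exact: irr.
  - exact: tr.
  - have [lt|E|lt] := tot X Y; [by constructor 1| |by constructor 3].
    by constructor 2; subst Y; congr exist; exact: Prop_irrelevance.
  - move=> /ltE lt.
    have [phi [Dphi nphi lt1 lt2]] :=
      nonstandard_between cohC D2C (repD X) (repD Y) nX lt.
    have [Z E] := inN _ Dphi nphi; exists Z; split; apply/ltE.
      exact: feq_flt (cpow_dom_feq (repD X)) (feq_sym E) lt1.
    exact: feq_flt (feq_sym E) (cpow_dom_feq (repD Y)) lt2.
  - split.
      have [phi [Dphi nphi lt]] := nonstandard_greater cohC (repD X) nX.
      have [Z E] := inN _ Dphi nphi; exists Z; apply/ltE.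
      exact: feq_flt (cpow_dom_feq (repD X)) (feq_sym E) lt.
    have [phi [Dphi nphi lt]] := nonstandard_smaller cohC (repD X) nX.
    have [Z E] := inN _ Dphi nphi; exists Z; apply/ltE.
    exact: feq_flt (feq_sym E) (cpow_dom_feq (repD X)) lt.
have [phi0 Dphi0 nphi0] := nonstandard_exists cohC.
have [x0 _] := inN _ Dphi0 nphi0.
(* Numbers that belong to no nonstandard element are sent to the default [x0]. *)
have [u uP] : exists u : nat -> {classic N}, forall x, exists n, u n = x.
  have [num [num_ex num_feq]] := partial_computable_enumeration C denseL.
  have /choice[u Hu] : forall n, exists x : N,
      (exists y : N, num n (rep (proj1_sig y))) -> num n (rep (proj1_sig x)).
    by move=> n; have [[y Hy]|nH] := pselect (exists y : N, num n (rep (proj1_sig y)));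
      [exists y|exists x0].
  exists u => x; have [n Hn] := num_ex _ (repD (proj1_sig x)); exists n.
  have Hun := Hu n (ex_intro _ x Hn).
  have := rep_inj _ _ (num_feq _ _ _ (repD _) (repD _) Hun Hn).
  case: (u n) x {Hn Hun} => [X nX] [Y nY] /= E; subst Y.
  by congr exist; exact: Prop_irrelevance.
have [w wP] := rat_enumeration.
have [h [h' hK h'K] h_mono] := cantor_isomorphism dN rat_dense_order uP wP.
have [g [g' gK g'K] g_mono] := denseL_omega.
(* Standard elements go to omega by their constant value, nonstandard ones to the rationals by
   [h]. *)
have /choice[F HF] : forall X, exists r : nat + rat,
    (exists x : {n | inL n}, feq C (rep X) (const_fun (val x)) /\ r = inl (g x)) \/
    (exists nX : ~ standard C (rep X), r = inr (h (exist _ X nX))).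
  move=> X; have [[x Lx E]|nX] := pselect (standard C (rep X)).
    pose x' := exist (fun n => inL n) x Lx.
    by exists (inl (g x')); left; exists x'.
  by exists (inr (h (exist _ X nX))); right; exists nX.
apply: (@order_iso_surj _ _ _ _ F) => //.
- by move=> [n|q] /=; rewrite /omega_lt /eta_lt ?ltnn ?Order.POrderTheory.ltxx.
- move=> [m|p] [n|q] [k|r] //=; rewrite /omega_lt /eta_lt.
    exact: ltn_trans.
  exact: Order.POrderTheory.lt_trans.
- move=> X Y; have [[x [EX ->]]|[nX ->]] := HF X; have [[y [EY ->]]|[nY ->]] := HF Y.
  + move=> /ltE/(feq_flt EX EY)/(ae_ex cohC)[n [_ [x' [y' [[<-] [<-]]]]]] lt.
    by apply/g_mono.
  + by [].
  + move=> /ltE/(feq_flt (cpow_dom_feq (repD X)) EY) lt; case: nX.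
    by apply: flt_standard lt => //; exact: repD.
  + by move=> lt; apply/h_mono.
- move=> [k|q].
    have [X E] := rep_surj _ (cpow_dom_const C (valP (g' k))); exists X.
    have [[x [E' ->]]|[nX _]] := HF X; last first.
      by case: nX; exists (val (g' k)) => //; exact: (valP (g' k)).
    congr inl; rewrite -[k in RHS]g'K; congr g; apply: val_inj.
    have [n [_ [z [[xz] [gz]]]]] := ae_ex cohC (feq_trans (feq_sym E') E).
    exact: etrans xz (esym gz).
  have [[X nX] hX] : exists x, h x = q by exists (h' q).
  exists X; have [[x [E' ->]]|[nX' ->]] := HF X.
    by case: (nX); exists (val x) => //; exact: (valP x).
  by rewrite -hX; congr (inr (h _)); congr exist; exact: Prop_irrelevance.
Qed.
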